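(* Consider an interior grid point $(x_i,y_j)\notin\Gamma$ such that $(x_i^*,y_j^* ):=(\xi,\zeta)=(x_i-w_1h,y_j-w_2h)$ with $0<w_1,w_2<1$. Assume that $u_p$ and $f_p$ have uniformly continuous partial derivatives of (total) orders up to two and zero, respectively, in $\Omega_p$ for $p=1,2,3,4$, and that the one-dimensional functions $\phi_p$ and $\psi_p$ on $\Gamma_p$ have uniformly continuous derivatives of orders up to two and one, respectively, for $p=1,2,3,4$. Let $\mathcal{L}_h$ be the discrete operator with stencil coefficients $$C_{-1,0}=-\frac{a_1a_2r_2+a_1a_3r_1}{\beta},\quad C_{0,-1}=-\frac{a_1a_3r_4+a_2a_3r_3}{\beta},$$ $$C_{0,1}=-\frac{a_1a_2r_8+a_1a_3r_7+a_2^2r_6+a_2a_3r_5}{\beta},\quad C_{1,0}=-\frac{a_1a_2r_{12}+a_1a_3r_{11}+a_2^2r_{10}+a_2a_3r_9}{\beta},$$ $$C_{0,0}=1,\quad C_{-1,-1}=C_{-1,1}=C_{1,-1}=C_{1,1}=0,$$ where $\beta:=-(a_1a_2s_4+a_1a_3s_3+a_2^2s_2+a_2a_3s_1)>0$ and $$r_1=2w_2^2-w_2+1,\ r_2=-2w_2^2+w_2+1,\ r_3=-2w_1^2+w_1+1,\ r_4=2w_1^2-w_1+1,\ r_5=-w_2(2w_1^2-w_1-1),$$ $$r_6=(w_2-1)(2w_1^2-w_1-1),\ r_7=w_2(2w_1^2-w_1+1),\ r_8=-(w_2-1)(2w_1^2-w_1+1),\ r_9=-(2w_2^2-w_2+1)(w_1-1),$$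 $$r_{10}=(2w_2^2-w_2-1)(w_1-1),\ r_{11}=(2w_2^2-w_2+1)w_1,\ r_{12}=-(2w_2^2-w_2-1)w_1,$$ $$s_1=2(w_1-1)(w_1w_2+w_2^2+w_1+1),\ s_2=2(1-w_2)(w_1-1)(w_1+w_2+1),$$ $$s_3=-2(w_2+1)w_1^2-2(w_2^2-w_2)w_1-2w_2^2-2,\ s_4=2(w_2-1)(w_1^2+w_1w_2+w_2+1).$$ Then the compact 9-point finite difference scheme $h^{-1}\mathcal{L}_hu_h=h^{-1}F$ has a second order of consistency at the grid point $(x_i,y_j)$, i.e. $h^{-1}(\mathcal{L}_hu-F)=O(h^2)$ as $h\to0$, where $$F:=\sum_{(n,m)\in\Lambda_2^1}F^{1}_{m,n}+\sum_{(m,n)\in\Lambda_0}F_{m,n}+\sum_{(n,m)\in\Lambda_2^1}\Phi^1_{m,n}+\sum_{m=0}^2\Phi_m+\sum_{(n,m)\in\Lambda_2^1}\Psi^1_{m,n}+\sum_{m=0}^1\Psi_m .$$ Furthermore, $\{C_{k,\ell}\}_{k,\ell=-1,0,1}$ satisfy both the sign condition ($C_{0,0}>0$ and $C_{k,\ell}\le0$ for all $(k,\ell)\neq(0,0)$) and the summation condition $\sum_{k=-1}^1\sum_{\ell=-1}^1C_{k,\ell}=0$ for all positive $a_1,a_2,a_3,a_4$ and all $(w_1,w_2)\in(0,1)^2$.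
   Context: **Problem.** Let $l_1<l_2$, $l_3<l_4$ be real with $l_4-l_3=N_0(l_2-l_1)$ for a positive integer $N_0$, let $\Omega=(l_1,l_2)\times(l_3,l_4)$ and $(\xi,\zeta)\in\Omega$. Put $\Gamma_1=\{\xi\}\times(\zeta,l_4)$, $\Gamma_2=\{\xi\}\times(l_3,\zeta)$, $\Gamma_3=(\xi,l_2)\times\{\zeta\}$, $\Gamma_4=(l_1,\xi)\times\{\zeta\}$, $\Gamma=\Gamma_1\cup\Gamma_2\cup\Gamma_3\cup\Gamma_4\cup\{(\xi,\zeta)\}$, and $\Omega_1=(l_1,\xi)\times(\zeta,l_4)$, $\Omega_2=(\xi,l_2)\times(\zeta,l_4)$, $\Omega_3=(\xi,l_2)\times(l_3,\zeta)$, $\Omega_4=(l_1,\xi)\times(l_3,\zeta)$. The coefficient $a$ equals a positive constant $a_p$ on $\Omega_p$; $u_p$ and $f_p$ denote the restrictions of $u$ and $f$ to $\Omega_p$ (with their derivatives extended continuously to $\overline{\Omega_p}$). The function $u$ is the exact solution of the elliptic cross-interface problem $$-\nabla\cdot(a\nabla u)=f\ \text{in }\Omega\setminus\Gamma,\quad [u]=\phi_p,\ [a\nabla u\cdot\vec n]=\psi_p\ \text{on }\Gamma_p\ (p=1,2,3,4),\quad u=g\ \text{on }\partial\Omega .$$ On $\Gamma_1,\Gamma_2$ the bracket is the limit $x\to\xi^+$ minus the limit $x\to\xi^-$ and $a\nabla u\cdot\vec n=a\,\partial u/\partial x$; on $\Gamma_3,\Gamma_4$ it is the limit $y\to\zeta^+$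 minus the limit $y\to\zeta^-$ and $a\nabla u\cdot\vec n=a\,\partial u/\partial y$. **Mesh.** $x_i=l_1+ih$ ($0\le i\le N_1$), $y_j=l_3+jh$ ($0\le j\le N_2$), $h=(l_2-l_1)/N_1$, $N_2=N_0N_1$; interior grid points are those in $\Omega$. For real stencil coefficients $C_{k,\ell}$, $\mathcal{L}_hu_h:=\sum_{k,\ell=-1}^1C_{k,\ell}(u_h)_{i+k,j+\ell}$ for a grid function $u_h$, and $\mathcal{L}_hu:=\sum_{k,\ell=-1}^1C_{k,\ell}\,u(x_i+kh,y_j+\ell h)$ for the exact solution. The scheme $h^{-1}\mathcal{L}_hu_h=h^{-1}F$ has order of consistency $r$ if $h^{-1}(\mathcal{L}_hu-F)=O(h^r)$ as $h\to0$ (with $w_1,w_2$ fixed, constant independent of $h$). **Notation.** $f_p^{(m,n)}=\frac{\partial^{m+n}f_p}{\partial x^m\partial y^n}(\xi,\zeta)$. For $p=1,2$, $\phi_p^{(n)},\psi_p^{(n)}$ are the $n$-th $y$-derivatives of $\phi_p(\xi,y),\psi_p(\xi,y)$ and for $p=3,4$ the $n$-th $x$-derivatives of $\phi_p(x,\zeta),\psi_p(x,\zeta)$, evaluated (as one-sided limits along $\Gamma_p$) at $(\xi,\zeta)$. $\Lambda_M=\{(m,n)\in\mathbb{Z}_{\ge0}^2: m+n\le M\}$, $\Lambda^1_M=\{(m,n)\in\Lambda_M: m\in\{0,1\}\}$; a sum over $(n,m)\in\Lambda_M^1$ means $n\in\{0,1\}$, $m\ge0$, $m+n\le M$. $\mathrm{odd}(m)=0$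 for $m$ even and $1$ for $m$ odd; terms multiplied by $\mathrm{odd}(\cdot)=0$ are zero, and empty sums are zero. Define $$G_{m,n}(x,y)=\sum_{\ell=0}^{\lfloor n/2\rfloor}\frac{(-1)^\ell x^{m+2\ell}y^{n-2\ell}}{(m+2\ell)!(n-2\ell)!},\qquad H_{m,n}(x,y)=\sum_{\ell=1}^{1+\lfloor n/2\rfloor}\frac{(-1)^\ell x^{m+2\ell}y^{n-2\ell+2}}{(m+2\ell)!(n-2\ell+2)!},$$ $$G^1_{m,n}=\sum_{\ell=0}^1C_{-1,\ell}G_{m,n}((w_1-1)h,(w_2+\ell)h),\quad G^3_{m,n}=\sum_{k=0}^1C_{k,-1}G_{n,m}((w_2-1)h,(w_1+k)h),\quad G^4_{m,n}=C_{-1,-1}G_{n,m}((w_2-1)h,(w_1-1)h),$$ $$H^1_{m,n}=\sum_{\ell=0}^1C_{-1,\ell}H_{m,n}((w_1-1)h,(w_2+\ell)h),\quad H^2_{m,n}=\sum_{k=0}^1\sum_{\ell=0}^1C_{k,\ell}H_{m,n}((w_1+k)h,(w_2+\ell)h),$$ $$H^3_{m,n}=\sum_{k=0}^1C_{k,-1}H_{n,m}((w_2-1)h,(w_1+k)h),\quad H^4_{m,n}=C_{-1,-1}H_{n,m}((w_2-1)h,(w_1-1)h),$$ $$F^1_{m,n}=\frac1{a_2}\Big(\frac{a_2}{a_3}\Big)^n\sum_{s=1}^{\lfloor m/2\rfloor}(-1)^sf_2^{(m-2s,n+2s-2)}G^3_{m,n}+\frac1{a_1}\Big(\frac{a_1}{a_4}\Big)^n\sum_{s=1}^{\lfloor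 m/2\rfloor}(-1)^sf_1^{(m-2s,n+2s-2)}G^4_{m,n},\qquad F_{m,n}=\sum_{p=1}^4\frac{f_p^{(m,n)}}{a_p}H^p_{m,n},$$ $$\Phi^1_{m,n}=-(-1)^{\lfloor m/2\rfloor}\mathrm{odd}(m+1)\,\phi_1^{(m+n)}\Big(\frac{a_1}{a_4}\Big)^nG^4_{m,n},\qquad \Phi_m=-\phi_1^{(m)}G^1_{0,m}-\sum_{p=3}^4\phi_p^{(m)}G^p_{m,0},$$ $$\Psi^1_{m,n}=-(-1)^{\lfloor m/2\rfloor}\frac{\mathrm{odd}(m)}{a_1}\psi_1^{(m+n-1)}\Big(\frac{a_1}{a_4}\Big)^nG^4_{m,n},\qquad \Psi_m=-\frac{\psi_1^{(m)}}{a_1}G^1_{1,m}-\sum_{p=3}^4\frac{\psi_p^{(m)}}{a_p}G^p_{m,1}.$$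
   Formalization: The O(h^2) consistency claim is proved under the added hypothesis that the second-order partial derivatives of each u_p are Lipschitz on Omega_p, since it fails as stated; under the stated regularity alone the truncation error is shown to be o(h). *)

(* Defs.v *)
From Stdlib Require Import Reals ZArith Lra Lia.
From Coquelicot Require Import Coquelicot.
Open Scope R_scope.

(* The rectangle (l1,l2) x (l3,l4) and the crossing point (xi,zeta). *)
Record cross := Cross { l1 : R; l2 : R; l3 : R; l4 : R; xi : R; zeta : R }.

Definition cross_wf (D : cross) (N0 : nat) : Prop :=
  l1 D < l2 D /\ l3 D < l4 D /\
  (0 < N0)%nat /\ l4 D - l3 D = INR N0 * (l2 D - l1 D) /\
  l1 D < xi D < l2 D /\ l3 D < zeta D < l4 D.

Definition Omega (D : cross) (x y : R) : Prop :=
  l1 D < x < l2 D /\ l3 D < y < l4 D.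

Definition boundary (D : cross) (x y : R) : Prop :=
  l1 D <= x <= l2 D /\ l3 D <= y <= l4 D /\ ~ Omega D x y.

(* The index p of Omega_p, Gamma_p, a_p, phi_p, psi_p ranges over 1..4. *)
Definition quad (p : nat) : Prop := (1 <= p <= 4)%nat.

Definition Omega_ (D : cross) (p : nat) (x y : R) : Prop :=
  match p with
  | 1%nat => l1 D < x < xi D /\ zeta D < y < l4 D
  | 2%nat => xi D < x < l2 D /\ zeta D < y < l4 D
  | 3%nat => xi D < x < l2 D /\ l3 D < y < zeta D
  | 4%nat => l1 D < x < xi D /\ l3 D < y < zeta D
  | _ => False
  end.

(* Gamma_p is parametrized by its free coordinate: y for p = 1, 2 and x for
   p = 3, 4; arc D p is the range of that coordinate and tip D p its value at
   the crossing point. *)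
Definition arc (D : cross) (p : nat) (t : R) : Prop :=
  match p with
  | 1%nat => zeta D < t < l4 D
  | 2%nat => l3 D < t < zeta D
  | 3%nat => xi D < t < l2 D
  | 4%nat => l1 D < t < xi D
  | _ => False
  end.

Definition tip (D : cross) (p : nat) : R :=
  match p with 1%nat | 2%nat => zeta D | _ => xi D end.

Definition Gamma_ (D : cross) (p : nat) (x y : R) : Prop :=
  match p with
  | 1%nat | 2%nat => x = xi D /\ arc D p y
  | 3%nat | 4%nat => arc D p x /\ y = zeta D
  | _ => False
  end.

Definition Gamma (D : cross) (x y : R) : Prop :=
  (exists p, quad p /\ Gamma_ D p x y) \/ (x = xi D /\ y = zeta D).

Definition unif_cont1 (A : R -> Prop) (v : R -> R) : Prop :=
  forall eps, 0 < eps -> exists delta, 0 < delta /\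
    forall s t, A s -> A t -> Rabs (s - t) < delta -> Rabs (v s - v t) < eps.

Definition unif_cont2 (A : R -> R -> Prop) (v : R -> R -> R) : Prop :=
  forall eps, 0 < eps -> exists delta, 0 < delta /\
    forall x y x' y', A x y -> A x' y' ->
      Rabs (x - x') < delta -> Rabs (y - y') < delta ->
      Rabs (v x y - v x' y') < eps.

(* For second derivatives that are merely uniformly continuous the second-order
   Taylor remainder is o(h^2); it is O(h^3) when they are Lipschitz. *)
Definition lipschitz2 (A : R -> R -> Prop) (v : R -> R -> R) : Prop :=
  exists L, forall x y x' y', A x y -> A x' y' ->
    Rabs (v x y - v x' y') <= L * (Rabs (x - x') + Rabs (y - y')).

Definition unif_derivs1 (M : nat) (A : R -> Prop) (v : R -> R) : Prop :=
  forall n, (n <= M)%nat ->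
    (forall t, A t -> ex_derive_n v n t) /\ unif_cont1 A (Derive_n v n).

Definition unif_derivs2 (M : nat) (A : R -> R -> Prop) (v : R -> R -> R) : Prop :=
  (forall x y, A x y -> ex_diff_n v M x y) /\
  (forall m n, (m + n <= M)%nat -> unif_cont2 A (partial_derive m n v)).

Definition is_jump (v : R -> R) (t J : R) : Prop :=
  exists vr vl,
    filterlim v (at_right t) (locally vr) /\
    filterlim v (at_left t) (locally vl) /\
    J = vr - vl.

Definition flux_x (a u : R -> R -> R) (x y : R) : R :=
  a x y * partial_derive 1 0 u x y.

Definition flux_y (a u : R -> R -> R) (x y : R) : R :=
  a x y * partial_derive 0 1 u x y.

(* At the points of the boundary which are end points of an arc Gamma_p the
   solution may itself jump, so g is not required to be its trace there. *)
Record cross_solution (D : cross) (a_ : nat -> R) (a f : R -> R -> R)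
    (phi psi : nat -> R -> R) (g u : R -> R -> R) : Prop := {
  sol_coeff : forall p x y, quad p -> Omega_ D p x y -> a x y = a_ p;
  sol_pde : forall x y, Omega D x y -> ~ Gamma D x y ->
    - (partial_derive 1 0 (flux_x a u) x y +
       partial_derive 0 1 (flux_y a u) x y) = f x y;
  sol_jump_x : forall p y, (p = 1 \/ p = 2)%nat -> arc D p y ->
    is_jump (fun x => u x y) (xi D) (phi p y) /\
    is_jump (fun x => flux_x a u x y) (xi D) (psi p y);
  sol_jump_y : forall p x, (p = 3 \/ p = 4)%nat -> arc D p x ->
    is_jump (fun y => u x y) (zeta D) (phi p x) /\
    is_jump (fun y => flux_y a u x y) (zeta D) (psi p x);
  sol_bdry : forall x y, boundary D x y -> u x y = g x y;
  sol_trace : forall x y, boundary D x y -> x <> xi D -> y <> zeta D ->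
    filterlim (fun q : R * R => u (fst q) (snd q))
      (within (fun q => Omega D (fst q) (snd q)) (locally (x, y)))
      (locally (g x y))
}.

(* f_p^(m,n) and phi_p^(n), psi_p^(n): limits at (xi,zeta) from inside Omega_p,
   respectively along Gamma_p. *)
Definition corner2 (D : cross) (v : R -> R -> R) (p m n : nat) : R :=
  iota (fun l : R =>
    filterlim (fun q : R * R => partial_derive m n v (fst q) (snd q))
      (within (fun q => Omega_ D p (fst q) (snd q)) (locally (xi D, zeta D)))
      (locally l)).

Definition corner1 (D : cross) (v : nat -> R -> R) (p n : nat) : R :=
  iota (fun l : R =>
    filterlim (Derive_n (v p) n) (within (arc D p) (locally (tip D p)))
      (locally l)).

Definition mesh_h (D : cross) (N1 : nat) : R := (l2 D - l1 D) / INR N1.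
Definition mesh_x (D : cross) (N1 i : nat) : R := l1 D + INR i * mesh_h D N1.
Definition mesh_y (D : cross) (N1 j : nat) : R := l3 D + INR j * mesh_h D N1.

(* The sum over lo <= k <= hi, for lo <= hi. *)
Definition sumZ (lo hi : Z) (F : Z -> R) : R :=
  sum_n_m (fun i => F (lo + Z.of_nat i)%Z) 0 (Z.to_nat (hi - lo)).

Definition stencil_op (C : Z -> Z -> R) (u : R -> R -> R) (h x y : R) : R :=
  sumZ (-1) 1 (fun k => sumZ (-1) 1 (fun l =>
    C k l * u (x + IZR k * h) (y + IZR l * h))).

Definition sign_condition (C : Z -> Z -> R) : Prop :=
  0 < C 0%Z 0%Z /\
  forall k l, (-1 <= k <= 1)%Z -> (-1 <= l <= 1)%Z -> (k, l) <> (0, 0)%Z ->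
    C k l <= 0.

Definition summation_condition (C : Z -> Z -> R) : Prop :=
  sumZ (-1) 1 (fun k => sumZ (-1) 1 (fun l => C k l)) = 0.

(* An interior grid point (x_i,y_j), off Gamma, of the mesh with N1 cells in x
   and N0 * N1 cells in y, such that (xi,zeta) = (x_i - w1 h, y_j - w2 h). *)
Definition cross_point (D : cross) (N0 N1 i j : nat) (w1 w2 : R) : Prop :=
  (0 < i < N1)%nat /\ (0 < j < N0 * N1)%nat /\
  ~ Gamma D (mesh_x D N1 i) (mesh_y D N1 j) /\
  0 < w1 < 1 /\ 0 < w2 < 1 /\
  xi D = mesh_x D N1 i - w1 * mesh_h D N1 /\
  zeta D = mesh_y D N1 j - w2 * mesh_h D N1.

(* Sum over m, n >= 0 with m + n <= M. *)
Definition sum_Lambda (M : nat) (T : nat -> nat -> R) : R :=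
  sum_n_m (fun m => sum_n_m (fun n => T m n) 0 (M - m)) 0 M.

(* Sum over m >= 0 and n in {0,1} with m + n <= M. *)
Definition sum_Lambda1 (M : nat) (T : nat -> nat -> R) : R :=
  sum_n_m (fun n => sum_n_m (fun m => T m n) 0 (M - n)) 0 (Nat.min 1 M).

Definition oddR (m : nat) : R := if Nat.odd m then 1 else 0.

Definition G (m n : nat) (x y : R) : R :=
  sum_n_m (fun l => (-1) ^ l * x ^ (m + 2 * l) * y ^ (n - 2 * l) /
                    (INR (fact (m + 2 * l)) * INR (fact (n - 2 * l))))
          0 (n / 2).

Definition H (m n : nat) (x y : R) : R :=
  sum_n_m (fun l => (-1) ^ l * x ^ (m + 2 * l) * y ^ (n + 2 - 2 * l) /
                    (INR (fact (m + 2 * l)) * INR (fact (n + 2 - 2 * l))))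
          1 (1 + n / 2).

Section RightHandSide.

Context (C : Z -> Z -> R) (w1 w2 h : R).

Definition G1 (m n : nat) : R :=
  sumZ 0 1 (fun l => C (-1)%Z l * G m n ((w1 - 1) * h) ((w2 + IZR l) * h)).
Definition G3 (m n : nat) : R :=
  sumZ 0 1 (fun k => C k (-1)%Z * G n m ((w2 - 1) * h) ((w1 + IZR k) * h)).
Definition G4 (m n : nat) : R :=
  C (-1)%Z (-1)%Z * G n m ((w2 - 1) * h) ((w1 - 1) * h).

Definition H1 (m n : nat) : R :=
  sumZ 0 1 (fun l => C (-1)%Z l * H m n ((w1 - 1) * h) ((w2 + IZR l) * h)).
Definition H2 (m n : nat) : R :=
  sumZ 0 1 (fun k => sumZ 0 1 (fun l =>
    C k l * H m n ((w1 + IZR k) * h) ((w2 + IZR l) * h))).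
Definition H3 (m n : nat) : R :=
  sumZ 0 1 (fun k => C k (-1)%Z * H n m ((w2 - 1) * h) ((w1 + IZR k) * h)).
Definition H4 (m n : nat) : R :=
  C (-1)%Z (-1)%Z * H n m ((w2 - 1) * h) ((w1 - 1) * h).

(* fc p m n, phic p n and psic p n stand for f_p^(m,n), phi_p^(n), psi_p^(n). *)
Context (a_ : nat -> R) (fc : nat -> nat -> nat -> R) (phic psic : nat -> nat -> R).

Definition F1 (m n : nat) : R :=
  / a_ 2%nat * (a_ 2%nat / a_ 3%nat) ^ n *
    sum_n_m (fun s => (-1) ^ s * fc 2%nat (m - 2 * s)%nat (n + 2 * s - 2)%nat
                      * G3 m n) 1 (m / 2) +
  / a_ 1%nat * (a_ 1%nat / a_ 4%nat) ^ n *
    sum_n_m (fun s => (-1) ^ s * fc 1%nat (m - 2 * s)%nat (n + 2 * s - 2)%nat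
                      * G4 m n) 1 (m / 2).

Definition F0 (m n : nat) : R :=
  fc 1%nat m n / a_ 1%nat * H1 m n + fc 2%nat m n / a_ 2%nat * H2 m n +
  fc 3%nat m n / a_ 3%nat * H3 m n + fc 4%nat m n / a_ 4%nat * H4 m n.

Definition Phi1 (m n : nat) : R :=
  - (-1) ^ (m / 2) * oddR (m + 1) * phic 1%nat (m + n)%nat *
    (a_ 1%nat / a_ 4%nat) ^ n * G4 m n.

Definition Phi0 (m : nat) : R :=
  - phic 1%nat m * G1 0 m - (phic 3%nat m * G3 m 0 + phic 4%nat m * G4 m 0).

Definition Psi1 (m n : nat) : R :=
  - (-1) ^ (m / 2) * (oddR m / a_ 1%nat) * psic 1%nat (m + n - 1)%nat *
    (a_ 1%nat / a_ 4%nat) ^ n * G4 m n.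

Definition Psi0 (m : nat) : R :=
  - (psic 1%nat m / a_ 1%nat) * G1 1 m -
    (psic 3%nat m / a_ 3%nat * G3 m 1 + psic 4%nat m / a_ 4%nat * G4 m 1).

Definition rhs_F : R :=
  sum_Lambda1 2 F1 + sum_Lambda 0 F0 + sum_Lambda1 2 Phi1 +
  sum_n_m Phi0 0 2 + sum_Lambda1 2 Psi1 + sum_n_m Psi0 0 1.

End RightHandSide.

Section Coefficients.

Context (a_ : nat -> R) (w1 w2 : R).

Let a1 := a_ 1%nat.
Let a2 := a_ 2%nat.
Let a3 := a_ 3%nat.

Definition r1 : R := 2 * w2 ^ 2 - w2 + 1.
Definition r2 : R := - 2 * w2 ^ 2 + w2 + 1.
Definition r3 : R := - 2 * w1 ^ 2 + w1 + 1.
Definition r4 : R := 2 * w1 ^ 2 - w1 + 1.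
Definition r5 : R := - w2 * (2 * w1 ^ 2 - w1 - 1).
Definition r6 : R := (w2 - 1) * (2 * w1 ^ 2 - w1 - 1).
Definition r7 : R := w2 * (2 * w1 ^ 2 - w1 + 1).
Definition r8 : R := - (w2 - 1) * (2 * w1 ^ 2 - w1 + 1).
Definition r9 : R := - (2 * w2 ^ 2 - w2 + 1) * (w1 - 1).
Definition r10 : R := (2 * w2 ^ 2 - w2 - 1) * (w1 - 1).
Definition r11 : R := (2 * w2 ^ 2 - w2 + 1) * w1.
Definition r12 : R := - (2 * w2 ^ 2 - w2 - 1) * w1.

Definition s1 : R := 2 * (w1 - 1) * (w1 * w2 + w2 ^ 2 + w1 + 1).
Definition s2 : R := 2 * (1 - w2) * (w1 - 1) * (w1 + w2 + 1).
Definition s3 : R :=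
  - 2 * (w2 + 1) * w1 ^ 2 - 2 * (w2 ^ 2 - w2) * w1 - 2 * w2 ^ 2 - 2.
Definition s4 : R := 2 * (w2 - 1) * (w1 ^ 2 + w1 * w2 + w2 + 1).

Definition beta : R :=
  - (a1 * a2 * s4 + a1 * a3 * s3 + a2 ^ 2 * s2 + a2 * a3 * s1).

Definition stencil (k l : Z) : R :=
  match k, l with
  | (-1)%Z, 0%Z => - (a1 * a2 * r2 + a1 * a3 * r1) / beta
  | 0%Z, (-1)%Z => - (a1 * a3 * r4 + a2 * a3 * r3) / beta
  | 0%Z, 1%Z =>
      - (a1 * a2 * r8 + a1 * a3 * r7 + a2 ^ 2 * r6 + a2 * a3 * r5) / beta
  | 1%Z, 0%Z =>
      - (a1 * a2 * r12 + a1 * a3 * r11 + a2 ^ 2 * r10 + a2 * a3 * r9) / beta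
  | 0%Z, 0%Z => 1
  | _, _ => 0
  end.

End Coefficients.

Definition F_h (D : cross) (a_ : nat -> R) (f : R -> R -> R)
    (phi psi : nat -> R -> R) (w1 w2 h : R) : R :=
  rhs_F (stencil a_ w1 w2) w1 w2 h a_ (corner2 D f) (corner1 D phi) (corner1 D psi).

(* h^-1 (L_h u - F) at the grid point (x_i,y_j). *)
Definition truncation (D : cross) (a_ : nat -> R) (f : R -> R -> R)
    (phi psi : nat -> R -> R) (u : R -> R -> R) (N1 i j : nat) (w1 w2 : R) : R :=
  let h := mesh_h D N1 in
  / h * (stencil_op (stencil a_ w1 w2) u h (mesh_x D N1 i) (mesh_y D N1 j)
         - F_h D a_ f phi psi w1 w2 h).

(* Main.v *)
Require Import Defs.
From Stdlib Require Import Reals ZArith.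
From Coquelicot Require Import Coquelicot.
From Stdlib Require Import Lra Lia.
Open Scope R_scope.

(* Each u_p has a second-order Taylor jet at the crossing point, read off from
   the limits of its derivatives there. Expanding the jumps along Gamma_1 and
   Gamma_3 in two ways, through these jets and through phi_p, psi_p themselves,
   relates the jets of u_1 and u_3 to that of u_2; the equation gives u_xx from
   u_yy and f_p. Five parameters of the jet of u_2 remain free, and the stencil
   annihilates each of them, so that applied to the jets it gives exactly F. The
   corner coefficients vanish, so Omega_4 plays no role. What is left is the
   Taylor remainder on a box of size O(h), which the coefficients, having
   absolute sum 2, do not amplify. *)

(** * Corner limits and Taylor expansions *)

(** The obstacle is that the crossing point lies in none of the open quadrants and arcs, so nothing
    can be evaluated or differentiated there: every expansion starts from a nearby interior point
    and passes to the limit. The jump relations, too, are one-sided limits at each fixed point of an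
    arc, and differentiating them along the arc would exchange two limits. Comparing two expansions
    of the same function avoids this: it takes only Taylor bounds that are uniform up to the
    interface, and the uniqueness of an expansion up to its order. All remainders are expressed
    through a bound [e] on the deviation of the second derivatives from their corner limits, with
    final estimate [32 * e * h]. Uniform continuity makes [e] small and a Lipschitz bound makes it
    of order h, so a single computation yields both rates. *)

Lemma increment_le (w dw : R -> R) (e x y : R) :
  (forall t, Rmin x y <= t <= Rmax x y ->
     is_derive w t (dw t) /\ Rabs (dw t) <= e) ->
  Rabs (w y - w x) <= e * Rabs (y - x).
Proof.
intros Hw.
destruct (MVT_gen w x y dw) as [c [Hc ->]].
- intros t Ht. apply Hw. lra.
- intros t Ht. apply derivable_continuous_pt.
  exists (dw t). apply is_derive_Reals. apply Hw, Ht.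
- rewrite Rabs_mult. apply Rmult_le_compat_r; [apply Rabs_pos|].
  apply Hw, Hc.
Qed.

Definition lim1 (A : R -> Prop) (v : R -> R) (t0 l : R) : Prop :=
  forall eps, 0 < eps -> exists delta, 0 < delta /\
    forall t, A t -> Rabs (t - t0) < delta -> Rabs (v t - l) < eps.

(** The two separate bounds are the balls of the product uniform space, so this is the restricted
    limit inside [corner2] in epsilon-delta form. *)
Definition lim2 (A : R -> R -> Prop) (v : R -> R -> R) (x0 y0 l : R) : Prop :=
  forall eps, 0 < eps -> exists delta, 0 < delta /\
    forall x y, A x y -> Rabs (x - x0) < delta -> Rabs (y - y0) < delta ->
      Rabs (v x y - l) < eps.

Definition rect (a b c d x y : R) : Prop := a < x < b /\ c < y < d.

Lemma filterlim_lim1 (A : R -> Prop) (v : R -> R) (t0 l : R) :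
  filterlim v (within A (locally t0)) (locally l) <-> lim1 A v t0 l.
Proof.
split.
- intros Hl eps He.
  destruct (proj1 (filterlim_locally v l) Hl (mkposreal eps He)) as [delta Hd].
  exists delta; split; [apply cond_pos|].
  intros t At Ht. exact (Hd t Ht At).
- intros Hl. apply filterlim_locally. intros eps.
  destruct (Hl eps (cond_pos eps)) as [delta [Hd Hv]].
  exists (mkposreal delta Hd). intros t Ht At. exact (Hv t At Ht).
Qed.

Lemma filterlim_lim2 (A : R -> R -> Prop) (v : R -> R -> R) (x0 y0 l : R) :
  filterlim (fun q : R * R => v (fst q) (snd q))
    (within (fun q => A (fst q) (snd q)) (locally (x0, y0))) (locally l) <->
  lim2 A v x0 y0 l.
Proof.
split.
- intros Hl eps He.
  destruct (proj1 (filterlim_locally _ l) Hl (mkposreal eps He)) as [delta Hd].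
  exists delta; split; [apply cond_pos|].
  intros x y Axy Hx Hy. exact (Hd (x, y) (conj Hx Hy) Axy).
- intros Hl. apply filterlim_locally. intros eps.
  destruct (Hl eps (cond_pos eps)) as [delta [Hd Hv]].
  exists (mkposreal delta Hd). intros [x y] [Hx Hy] Axy. exact (Hv x y Axy Hx Hy).
Qed.

(** Limits along a filter are unique only when the filter is proper. This is what lets the [iota] in
    [corner1] and [corner2] be evaluated at a point outside the set. *)
Lemma within_proper {T : UniformSpace} (A : T -> Prop) (x : T) :
  (forall eps : posreal, exists y, A y /\ ball x eps y) ->
  ProperFilter (within A (locally x)).
Proof.
intros HA. constructor.
- intros P [eps HP]. destruct (HA eps) as [y [Ay Hy]].
  exists y. exact (HP y Hy Ay).
- apply within_filter, locally_filter.
Qed.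

Lemma interval_near (a b x0 eps : R) :
  a < b -> a <= x0 <= b -> 0 < eps -> exists x, a < x < b /\ Rabs (x - x0) < eps.
Proof.
intros Hab Hx He.
(* As [x0] may be an end point, move towards the farther end, by at most a quarter of the length, to
   stay strictly inside. *)
destruct (Rle_lt_dec ((a + b) / 2) x0) as [H|H].
- exists (x0 - Rmin (eps / 2) ((b - a) / 4)).
  pose proof (Rmin_l (eps / 2) ((b - a) / 4)).
  pose proof (Rmin_r (eps / 2) ((b - a) / 4)).
  assert (0 < Rmin (eps / 2) ((b - a) / 4)) by (apply Rmin_pos; lra).
  split; [lra|]. apply Rabs_def1; lra.
- exists (x0 + Rmin (eps / 2) ((b - a) / 4)).
  pose proof (Rmin_l (eps / 2) ((b - a) / 4)).
  pose proof (Rmin_r (eps / 2) ((b - a) / 4)).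
  assert (0 < Rmin (eps / 2) ((b - a) / 4)) by (apply Rmin_pos; lra).
  split; [lra|]. apply Rabs_def1; lra.
Qed.

Lemma interval_proper (a b t0 : R) :
  a < b -> a <= t0 <= b -> ProperFilter (within (fun t => a < t < b) (locally t0)).
Proof.
intros Hab Ht. apply within_proper. intros eps.
exact (interval_near a b t0 eps Hab Ht (cond_pos eps)).
Qed.

Lemma rect_proper (a b c d x0 y0 : R) :
  a < b -> c < d -> a <= x0 <= b -> c <= y0 <= d ->
  ProperFilter (within (fun q => rect a b c d (fst q) (snd q)) (locally (x0, y0))).
Proof.
intros Hab Hcd Hx Hy. apply within_proper. intros eps.
destruct (interval_near a b x0 eps Hab Hx (cond_pos eps)) as [x [Ix Bx]].
destruct (interval_near c d y0 eps Hcd Hy (cond_pos eps)) as [y [Iy By]].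
exists (x, y). split; split; assumption.
Qed.

(** Uniform continuity makes the image of the filter Cauchy (radius [delta / 2], so that two points
    are within [delta]), and completeness of the reals supplies the limit. *)
Lemma unif_cont1_lim (A : R -> Prop) (v : R -> R) (t0 : R) :
  ProperFilter (within A (locally t0)) -> unif_cont1 A v ->
  exists l, filterlim v (within A (locally t0)) (locally l).
Proof.
intros HF Hv. apply (proj1 (filterlim_locally_cauchy (U := R_CompleteSpace) _)). intros eps.
destruct (Hv eps (cond_pos eps)) as [delta [Hd Hu]].
exists (fun t => A t /\ Rabs (t - t0) < delta / 2). split.
- assert (Hd2 : 0 < delta / 2) by lra.
  exists (mkposreal _ Hd2). intros t Ht At. split; [exact At|exact Ht].
- intros s t [As Hs] [At Ht]. apply Hu; auto.
  apply Rabs_def2 in Hs; apply Rabs_def2 in Ht; apply Rabs_def1; lra.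
Qed.

Lemma unif_cont2_lim (A : R -> R -> Prop) (v : R -> R -> R) (x0 y0 : R) :
  ProperFilter (within (fun q => A (fst q) (snd q)) (locally (x0, y0))) ->
  unif_cont2 A v ->
  exists l : R, filterlim (fun q : R * R => v (fst q) (snd q))
    (within (fun q => A (fst q) (snd q)) (locally (x0, y0))) (locally l).
Proof.
intros HF Hv. apply (proj1 (filterlim_locally_cauchy (U := R_CompleteSpace) _)). intros eps.
destruct (Hv eps (cond_pos eps)) as [delta [Hd Hu]].
exists (fun q => A (fst q) (snd q) /\
  Rabs (fst q - x0) < delta / 2 /\ Rabs (snd q - y0) < delta / 2). split.
- assert (Hd2 : 0 < delta / 2) by lra.
  exists (mkposreal _ Hd2). intros [x y] [Hx Hy] At. split; [exact At|].
  split; [exact Hx|exact Hy].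
- intros [s t] [s' t'] [As [Hs Hs']] [At [Ht Ht']]. simpl in *.
  apply Rabs_def2 in Hs; apply Rabs_def2 in Ht.
  apply Rabs_def2 in Hs'; apply Rabs_def2 in Ht'.
  apply Hu; auto; apply Rabs_def1; lra.
Qed.

Lemma quadrant_rect (D : cross) (N0 p : nat) : cross_wf D N0 -> quad p ->
  exists a b c d, Omega_ D p = rect a b c d /\ a < b /\ c < d /\
    a <= xi D <= b /\ c <= zeta D <= d.
Proof.
intros [_ [_ [_ [_ [Hx Hy]]]]] Hp. unfold quad in Hp.
assert (E : (p = 1 \/ p = 2 \/ p = 3 \/ p = 4)%nat) by lia.
destruct E as [-> | [-> | [-> | ->]]].
- exists (l1 D), (xi D), (zeta D), (l4 D). split; [reflexivity|lra].
- exists (xi D), (l2 D), (zeta D), (l4 D). split; [reflexivity|lra].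
- exists (xi D), (l2 D), (l3 D), (zeta D). split; [reflexivity|lra].
- exists (l1 D), (xi D), (l3 D), (zeta D). split; [reflexivity|lra].
Qed.

Lemma quadrant_proper (D : cross) (N0 p : nat) : cross_wf D N0 -> quad p ->
  ProperFilter (within (fun q => Omega_ D p (fst q) (snd q))
    (locally (xi D, zeta D))).
Proof.
intros HD Hp.
destruct (quadrant_rect D N0 p HD Hp) as (a & b & c & d & -> & Hab & Hcd & Hx & Hy).
now apply rect_proper.
Qed.

Lemma corner2_eq (D : cross) (N0 p m n : nat) (v : R -> R -> R) (l : R) :
  cross_wf D N0 -> quad p ->
  lim2 (Omega_ D p) (partial_derive m n v) (xi D) (zeta D) l ->
  corner2 D v p m n = l.
Proof.
intros HD Hp Hl.
pose proof (quadrant_proper D N0 p HD Hp) as HF.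
apply (iota_filterlim_locally (K := R_AbsRing) (V := R_CompleteNormedModule)
  (fun q : R * R => partial_derive m n v (fst q) (snd q))).
now apply (filterlim_lim2 (Omega_ D p) (partial_derive m n v)).
Qed.

(** [corner2] is defined by a choice operator and carries information only once a limit is known to
    exist; uniform continuity provides it. *)
Lemma corner2_lim (D : cross) (N0 p m n : nat) (v : R -> R -> R) :
  cross_wf D N0 -> quad p -> unif_cont2 (Omega_ D p) (partial_derive m n v) ->
  lim2 (Omega_ D p) (partial_derive m n v) (xi D) (zeta D) (corner2 D v p m n).
Proof.
intros HD Hp Hv.
destruct (unif_cont2_lim (Omega_ D p) (partial_derive m n v) (xi D) (zeta D)
  (quadrant_proper D N0 p HD Hp) Hv) as [l Hl].
apply filterlim_lim2 in Hl.
now rewrite (corner2_eq D N0 p m n v l HD Hp Hl).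
Qed.

(* Only the arcs 1 and 3, which start at the crossing point, are needed. *)
Lemma arc_interval (D : cross) (N0 p : nat) : cross_wf D N0 -> (p = 1 \/ p = 3)%nat ->
  exists b, tip D p < b /\ arc D p = (fun t => tip D p < t < b).
Proof.
intros [_ [_ [_ [_ [Hx Hy]]]]] [-> | ->].
- exists (l4 D). split; [simpl; lra|reflexivity].
- exists (l2 D). split; [simpl; lra|reflexivity].
Qed.

Lemma corner1_lim (D : cross) (N0 p n : nat) (v : nat -> R -> R) :
  cross_wf D N0 -> (p = 1 \/ p = 3)%nat -> unif_cont1 (arc D p) (Derive_n (v p) n) ->
  lim1 (arc D p) (Derive_n (v p) n) (tip D p) (corner1 D v p n).
Proof.
intros HD Hp Hv. apply filterlim_lim1. unfold corner1.
destruct (arc_interval D N0 p HD Hp) as [b [Hb Earc]].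
assert (HF : ProperFilter (within (arc D p) (locally (tip D p)))).
{ rewrite Earc. apply interval_proper; lra. }
destruct (unif_cont1_lim _ _ (tip D p) HF Hv) as [l Hl].
replace (iota _) with l; [exact Hl|symmetry].
exact (iota_filterlim_locally (K := R_AbsRing) (V := R_CompleteNormedModule) _ _ Hl).
Qed.

Lemma convex_interval (a b c d t : R) :
  a < c < b -> a < d < b -> Rmin c d <= t <= Rmax c d -> a < t < b.
Proof.
unfold Rmin, Rmax. destruct (Rle_dec c d); lra.
Qed.

Lemma convex_ball (x0 r c d t : R) :
  Rabs (c - x0) <= r -> Rabs (d - x0) <= r -> Rmin c d <= t <= Rmax c d ->
  Rabs (t - x0) <= r.
Proof.
intros Hc Hd Ht. apply Rabs_le_between in Hc. apply Rabs_le_between in Hd.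
apply Rabs_le_between. revert Ht. unfold Rmin, Rmax. destruct (Rle_dec c d); lra.
Qed.

Lemma toward_in_interval (a b x0 x s : R) :
  a <= x0 <= b -> a < x < b -> 0 < s <= 1 -> a < x0 + s * (x - x0) < b.
Proof. intros; split; nra. Qed.

Lemma toward_dist (x0 x s r : R) :
  Rabs (x - x0) <= r -> 0 < s <= 1 ->
  Rabs (x0 + s * (x - x0) - x0) <= s * r /\
  Rabs (x - (x0 + s * (x - x0))) <= r.
Proof.
intros Hx Hs.
replace (x0 + s * (x - x0) - x0) with (s * (x - x0)) by ring.
replace (x - (x0 + s * (x - x0))) with ((1 - s) * (x - x0)) by ring.
rewrite !Rabs_mult, (Rabs_pos_eq s), (Rabs_pos_eq (1 - s)) by lra.
pose proof (Rabs_pos (x - x0)). split; nra.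
Qed.

(** The mean value theorem cannot start at the corner. It starts at a point of the segment towards
    the corner where [w] is already below an arbitrary [eps], and follows one horizontal and one
    vertical leg inside the rectangle, each of length at most [r] and hence costing at most
    [e * r]. *)
Lemma corner_increment_le (a b c d x0 y0 r e : R) (w wx wy : R -> R -> R) :
  a <= x0 <= b -> c <= y0 <= d -> 0 < r ->
  lim2 (rect a b c d) w x0 y0 0 ->
  (forall x y, rect a b c d x y -> Rabs (x - x0) <= r -> Rabs (y - y0) <= r ->
     is_derive (fun t => w t y) x (wx x y) /\
     is_derive (fun t => w x t) y (wy x y) /\
     Rabs (wx x y) <= e /\ Rabs (wy x y) <= e) ->
  forall x y, rect a b c d x y -> Rabs (x - x0) <= r -> Rabs (y - y0) <= r ->
    Rabs (w x y) <= 2 * e * r.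
Proof.
intros Hx0 Hy0 Hr Hlim Hd x y Hxy Hx Hy.
apply le_epsilon. intros eps Heps.
destruct (Hlim eps Heps) as [delta [Hdelta Hw]].
(* The fraction of the segment that is kept: [delta / (2 * r)] puts the starting point within
   [delta] of the corner, and the cap 1 keeps it on the segment. *)
set (s := Rmin 1 (delta / (2 * r))).
assert (Hdr : 0 < delta / (2 * r)) by (apply Rdiv_lt_0_compat; lra).
assert (Hs : 0 < s <= 1) by (split; [apply Rmin_pos; lra|apply Rmin_l]).
assert (Hsr : s * r < delta).
{ apply Rle_lt_trans with (delta / (2 * r) * r).
  - apply Rmult_le_compat_r; [lra|apply Rmin_r].
  - replace (delta / (2 * r) * r) with (delta / 2) by (field; lra). lra. }
destruct (toward_dist x0 x s r Hx Hs) as [Dx Ex].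
destruct (toward_dist y0 y s r Hy Hs) as [Dy Ey].
destruct Hxy as [Ix Iy].
pose proof (toward_in_interval a b x0 x s Hx0 Ix Hs) as Ix'.
pose proof (toward_in_interval c d y0 y s Hy0 Iy Hs) as Iy'.
set (x' := x0 + s * (x - x0)) in *.
set (y' := y0 + s * (y - y0)) in *.
assert (srr : s * r <= r) by nra.
assert (He : 0 <= e).
{ apply Rle_trans with (Rabs (wx x y)); [apply Rabs_pos|].
  apply Hd; auto; split; assumption. }
assert (W0 : Rabs (w x' y' - 0) < eps).
{ apply Hw; [split; assumption|lra|lra]. }
assert (W1 : Rabs (w x y' - w x' y') <= e * Rabs (x - x')).
{ apply (increment_le (fun t => w t y') (fun t => wx t y')).
  intros t Ht. destruct (Hd t y') as (H1 & _ & H2 & _); auto.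
  - split; [apply (convex_interval a b x' x t)|]; assumption.
  - apply (convex_ball x0 r x' x t); auto; lra.
  - lra. }
assert (W2 : Rabs (w x y - w x y') <= e * Rabs (y - y')).
{ apply (increment_le (fun t => w x t) (fun t => wy x t)).
  intros t Ht. destruct (Hd x t) as (_ & H1 & _ & H2); auto.
  - split; [|apply (convex_interval c d y' y t)]; assumption.
  - apply (convex_ball y0 r y' y t); auto; lra. }
replace (w x y) with ((w x y - w x y') + (w x y' - w x' y') + (w x' y' - 0)) by ring.
pose proof (Rabs_triang ((w x y - w x y') + (w x y' - w x' y')) (w x' y' - 0)).
pose proof (Rabs_triang (w x y - w x y') (w x y' - w x' y')).
assert (e * Rabs (x - x') <= e * r) by (apply Rmult_le_compat_l; lra).
assert (e * Rabs (y - y') <= e * r) by (apply Rmult_le_compat_l; lra).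
lra.
Qed.

(** The derivative is bounded only on [(t0, t]], so that [e] may depend on [t], as it does in
    [expands_integrate]. *)
Lemma tip_increment_le (t0 b e t : R) (w dw : R -> R) :
  lim1 (fun s => t0 < s < b) w t0 0 -> t0 < t < b ->
  (forall s, t0 < s <= t -> is_derive w s (dw s) /\ Rabs (dw s) <= e) ->
  Rabs (w t) <= e * (t - t0).
Proof.
intros Hlim Ht Hd.
apply le_epsilon. intros eps Heps.
destruct (Hlim eps Heps) as [delta [Hdelta Hw]].
assert (He : 0 <= e).
{ apply Rle_trans with (Rabs (dw t)); [apply Rabs_pos|apply Hd; lra]. }
destruct (interval_near t0 t t0 delta) as [s [Hs Hsd]]; try lra.
assert (W0 : Rabs (w s - 0) < eps) by (apply Hw; lra).
assert (W1 : Rabs (w t - w s) <= e * Rabs (t - s)).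
{ apply (increment_le w dw). intros z Hz. apply Hd.
  rewrite Rmin_left, Rmax_right in Hz; lra. }
rewrite (Rabs_pos_eq (t - s)) in W1 by lra.
replace (w t) with ((w t - w s) + (w s - 0)) by ring.
pose proof (Rabs_triang (w t - w s) (w s - 0)). nra.
Qed.

Lemma rect_locally_2d (a b c d x y : R) :
  rect a b c d x y -> locally_2d (rect a b c d) x y.
Proof.
intros [Hx Hy].
assert (Hd : 0 < Rmin (Rmin (x - a) (b - x)) (Rmin (y - c) (d - y))).
{ repeat apply Rmin_pos; lra. }
exists (mkposreal _ Hd). simpl. intros u v Hu Hv.
pose proof (Rmin_l (Rmin (x - a) (b - x)) (Rmin (y - c) (d - y))).
pose proof (Rmin_r (Rmin (x - a) (b - x)) (Rmin (y - c) (d - y))).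
pose proof (Rmin_l (x - a) (b - x)). pose proof (Rmin_r (x - a) (b - x)).
pose proof (Rmin_l (y - c) (d - y)). pose proof (Rmin_r (y - c) (d - y)).
apply Rabs_def2 in Hu. apply Rabs_def2 in Hv.
split; lra.
Qed.

(** [partial_derive 1 1] differentiates in y first. That it is also the y-derivative of u_x is
    Schwarz's theorem, whose continuity hypotheses are contained in [ex_diff_n]. *)
Lemma ex_diff_2_derivatives (a b c d : R) (u : R -> R -> R) (x y : R) :
  (forall x y, rect a b c d x y -> ex_diff_n u 2 x y) ->
  rect a b c d x y ->
  is_derive (fun t => u t y) x (partial_derive 1 0 u x y) /\
  is_derive (fun t => u x t) y (partial_derive 0 1 u x y) /\
  is_derive (fun t => partial_derive 1 0 u t y) x (partial_derive 2 0 u x y) /\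
  is_derive (fun t => partial_derive 1 0 u x t) y (partial_derive 1 1 u x y) /\
  is_derive (fun t => partial_derive 0 1 u t y) x (partial_derive 1 1 u x y) /\
  is_derive (fun t => partial_derive 0 1 u x t) y (partial_derive 0 2 u x y).
Proof.
intros Hu Hxy.
assert (Hmixed : partial_derive 1 1 u x y =
  Derive (fun z => Derive (fun t => u t z) x) y).
{ apply Schwarz.
  - apply (locally_2d_impl (rect a b c d)); [|now apply rect_locally_2d].
    apply locally_2d_forall. intros s t Hst.
    destruct (Hu s t Hst) as (_ & H1 & H2 & (_ & H3 & H4 & _) & (_ & H5 & H6 & _)).
    repeat split; assumption.
  - destruct (Hu x y Hxy) as (_ & H1 & H2 & (_ & H3 & H4 & H7 & H8) & (_ & H5 & H6 & H9 & H10)).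
    apply H9.
  - destruct (Hu x y Hxy) as (_ & H1 & H2 & (_ & H3 & H4 & H7 & H8) & (_ & H5 & H6 & H9 & H10)).
    apply H8. }
destruct (Hu x y Hxy) as (_ & H1 & H2 & (_ & H3 & H4 & _) & (_ & H5 & H6 & _)).
refine (conj _ (conj _ (conj _ (conj _ (conj _ _))))).
- apply (Derive_correct (fun t => u t y)), H1.
- apply (Derive_correct (fun t => u x t)), H2.
- apply (Derive_correct (fun t => Derive (fun s => u s y) t)), H3.
- rewrite Hmixed. apply (Derive_correct (fun t => Derive (fun s => u s t) x)), H4.
- apply (Derive_correct (fun t => Derive (fun s => u t s) y)), H5.
- apply (Derive_correct (fun t => Derive (fun s => u x s) t)), H6.
Qed.

(** * Second-order Taylor jets at the corner *)

Definition jet (c : nat -> nat -> R) (X Y : R) : R :=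
  c 0%nat 0%nat + c 1%nat 0%nat * X + c 0%nat 1%nat * Y +
  c 2%nat 0%nat * X ^ 2 / 2 + c 1%nat 1%nat * X * Y + c 0%nat 2%nat * Y ^ 2 / 2.

Definition jet_x (c : nat -> nat -> R) (X Y : R) : R :=
  c 1%nat 0%nat + c 2%nat 0%nat * X + c 1%nat 1%nat * Y.

Definition jet_y (c : nat -> nat -> R) (X Y : R) : R :=
  c 0%nat 1%nat + c 1%nat 1%nat * X + c 0%nat 2%nat * Y.

Lemma lim2_minus_continuous (A : R -> R -> Prop) (v q : R -> R -> R) (x0 y0 l : R) :
  lim2 A v x0 y0 l -> q x0 y0 = l -> continuity_2d_pt q x0 y0 ->
  lim2 A (fun x y => v x y - q x y) x0 y0 0.
Proof.
intros Hv <- Hq eps He.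
assert (He2 : 0 < eps / 2) by lra.
destruct (Hv _ He2) as [d1 [Hd1 H1]].
destruct (Hq (mkposreal _ He2)) as [d2 H2]. simpl in H2.
exists (Rmin d1 d2). split; [apply Rmin_pos; [exact Hd1|apply cond_pos]|].
intros x y Axy Hx Hy.
pose proof (Rmin_l d1 d2). pose proof (Rmin_r d1 d2).
assert (K1 : Rabs (v x y - q x0 y0) < eps / 2) by (apply H1; auto; lra).
assert (K2 : Rabs (q x y - q x0 y0) < eps / 2) by (apply H2; lra).
apply Rabs_def2 in K1. apply Rabs_def2 in K2. apply Rabs_def1; lra.
Qed.

Lemma continuity_2d_pt_affine (k0 k1 k2 x0 y0 : R) :
  continuity_2d_pt (fun x y => k0 + k1 * (x - x0) + k2 * (y - y0)) x0 y0.
Proof.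
repeat first [apply continuity_2d_pt_plus | apply continuity_2d_pt_minus
 | apply continuity_2d_pt_mult | apply continuity_2d_pt_const
 | apply continuity_2d_pt_id1 | apply continuity_2d_pt_id2].
Qed.

Lemma continuity_2d_pt_jet (k : nat -> nat -> R) (x0 y0 : R) :
  continuity_2d_pt (fun x y => jet k (x - x0) (y - y0)) x0 y0.
Proof.
unfold jet, Rdiv, pow.
repeat first [apply continuity_2d_pt_plus | apply continuity_2d_pt_minus
 | apply continuity_2d_pt_mult | apply continuity_2d_pt_const
 | apply continuity_2d_pt_id1 | apply continuity_2d_pt_id2].
Qed.

(** Two rounds of [corner_increment_le]: the first, with derivative bound [e], gives [2 * e * r] for
    the first derivatives; the second, with that as derivative bound, gives [4 * e * r ^ 2] for the
    values. *)
Lemma corner_taylor (a b c d x0 y0 r e : R) (u : R -> R -> R)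
    (k : nat -> nat -> R) :
  a <= x0 <= b -> c <= y0 <= d -> 0 < r ->
  (forall x y, rect a b c d x y -> ex_diff_n u 2 x y) ->
  (forall m n, (m + n <= 2)%nat ->
     lim2 (rect a b c d) (partial_derive m n u) x0 y0 (k m n)) ->
  (forall m n x y, (m + n = 2)%nat -> rect a b c d x y ->
     Rabs (x - x0) <= r -> Rabs (y - y0) <= r ->
     Rabs (partial_derive m n u x y - k m n) <= e) ->
  forall x y, rect a b c d x y -> Rabs (x - x0) <= r -> Rabs (y - y0) <= r ->
    Rabs (u x y - jet k (x - x0) (y - y0)) <= 4 * e * r ^ 2 /\
    Rabs (partial_derive 1 0 u x y - jet_x k (x - x0) (y - y0)) <= 2 * e * r /\
    Rabs (partial_derive 0 1 u x y - jet_y k (x - x0) (y - y0)) <= 2 * e * r.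
Proof.
intros Hx0 Hy0 Hr Hu Hk He.
assert (Tx : forall x y, rect a b c d x y -> Rabs (x - x0) <= r -> Rabs (y - y0) <= r ->
  Rabs (partial_derive 1 0 u x y - jet_x k (x - x0) (y - y0)) <= 2 * e * r).
{ apply (corner_increment_le a b c d x0 y0 r e
    (fun x y => partial_derive 1 0 u x y - jet_x k (x - x0) (y - y0))
    (fun x y => partial_derive 2 0 u x y - k 2%nat 0%nat)
    (fun x y => partial_derive 1 1 u x y - k 1%nat 1%nat)); auto.
  - apply (lim2_minus_continuous _ (partial_derive 1 0 u)
      (fun x y => jet_x k (x - x0) (y - y0)) x0 y0 (k 1%nat 0%nat)).
    + apply Hk; lia.
    + unfold jet_x. ring.
    + apply continuity_2d_pt_affine.
  - intros x y Hxy Hx Hy.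
    destruct (ex_diff_2_derivatives a b c d u x y Hu Hxy) as (D1 & D2 & D3 & D4 & D5 & D6).
    refine (conj _ (conj _ (conj _ _))).
    + apply (is_derive_minus _ _ _ _ _ D3). unfold jet_x. auto_derive; auto. ring.
    + apply (is_derive_minus _ _ _ _ _ D4). unfold jet_x. auto_derive; auto. ring.
    + now apply He.
    + now apply He. }
assert (Ty : forall x y, rect a b c d x y -> Rabs (x - x0) <= r -> Rabs (y - y0) <= r ->
  Rabs (partial_derive 0 1 u x y - jet_y k (x - x0) (y - y0)) <= 2 * e * r).
{ apply (corner_increment_le a b c d x0 y0 r e
    (fun x y => partial_derive 0 1 u x y - jet_y k (x - x0) (y - y0))
    (fun x y => partial_derive 1 1 u x y - k 1%nat 1%nat)
    (fun x y => partial_derive 0 2 u x y - k 0%nat 2%nat)); auto.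
  - apply (lim2_minus_continuous _ (partial_derive 0 1 u)
      (fun x y => jet_y k (x - x0) (y - y0)) x0 y0 (k 0%nat 1%nat)).
    + apply Hk; lia.
    + unfold jet_y. ring.
    + apply continuity_2d_pt_affine.
  - intros x y Hxy Hx Hy.
    destruct (ex_diff_2_derivatives a b c d u x y Hu Hxy) as (D1 & D2 & D3 & D4 & D5 & D6).
    refine (conj _ (conj _ (conj _ _))).
    + apply (is_derive_minus _ _ _ _ _ D5). unfold jet_y. auto_derive; auto. ring.
    + apply (is_derive_minus _ _ _ _ _ D6). unfold jet_y. auto_derive; auto. ring.
    + now apply He.
    + now apply He. }
intros x y Hxy Hx Hy. split; [|split; [now apply Tx|now apply Ty]].
replace (4 * e * r ^ 2) with (2 * (2 * e * r) * r) by ring.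
revert x y Hxy Hx Hy.
apply (corner_increment_le a b c d x0 y0 r (2 * e * r)
  (fun x y => u x y - jet k (x - x0) (y - y0))
  (fun x y => partial_derive 1 0 u x y - jet_x k (x - x0) (y - y0))
  (fun x y => partial_derive 0 1 u x y - jet_y k (x - x0) (y - y0))); auto.
- apply (lim2_minus_continuous _ u
    (fun x y => jet k (x - x0) (y - y0)) x0 y0 (k 0%nat 0%nat)).
  + apply (Hk 0%nat 0%nat); lia.
  + unfold jet. field.
  + apply continuity_2d_pt_jet.
- intros x y Hxy Hx Hy.
  destruct (ex_diff_2_derivatives a b c d u x y Hu Hxy) as (D1 & D2 & D3 & D4 & D5 & D6).
  refine (conj _ (conj _ (conj _ _))).
  + apply (is_derive_minus _ _ _ _ _ D1). unfold jet, jet_x. auto_derive; auto. field.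
  + apply (is_derive_minus _ _ _ _ _ D2). unfold jet, jet_y. auto_derive; auto. field.
  + now apply Tx.
  + now apply Ty.
Qed.

(** * Asymptotic expansions along the interfaces *)

(** The expansion v = q + o((t - t0)^k), with [q] a function of the displacement. It is right-sided
    because Gamma_1 and Gamma_3 leave the crossing point in the increasing direction. *)
Definition expands (k : nat) (v : R -> R) (t0 : R) (q : R -> R) : Prop :=
  forall eps, 0 < eps -> exists delta, 0 < delta /\
    forall t, t0 < t < t0 + delta -> Rabs (v t - q (t - t0)) <= eps * (t - t0) ^ k.

(** An expansion of the derivative integrates to one of the next order once the values agree in the
    limit at [t0]. *)
Lemma expands_integrate (k : nat) (t0 b : R) (v dv q dq : R -> R) :
  t0 < b -> lim1 (fun t => t0 < t < b) v t0 (q 0) ->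
  (forall t, t0 < t < b -> is_derive v t (dv t)) ->
  (forall s, is_derive q s (dq s)) ->
  expands k dv t0 dq -> expands (S k) v t0 q.
Proof.
intros Hb Hlim Hv Hq Hdv eps Heps.
destruct (Hdv eps Heps) as [delta [Hdelta Hd]].
exists (Rmin delta (b - t0)). split; [apply Rmin_pos; lra|].
intros t Ht. pose proof (Rmin_l delta (b - t0)). pose proof (Rmin_r delta (b - t0)).
simpl pow. rewrite (Rmult_comm (t - t0)), <- Rmult_assoc.
apply (tip_increment_le t0 b _ t (fun s => v s - q (s - t0))
  (fun s => dv s - dq (s - t0))); [|lra|].
- intros e He.
  assert (He2 : 0 < e / 2) by lra.
  destruct (Hlim _ He2) as [d1 [Hd1 H1]].
  assert (Hc : filterlim q (locally 0) (locally (q 0))).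
  { apply (ex_derive_continuous q 0). eexists. apply Hq. }
  destruct (proj1 (filterlim_locally (U := R_UniformSpace) q (q 0)) Hc (mkposreal _ He2)) as [d2 H2].
  exists (Rmin d1 d2). split; [apply Rmin_pos; [exact Hd1|apply cond_pos]|].
  intros s Hs Hsd. pose proof (Rmin_l d1 d2). pose proof (Rmin_r d1 d2).
  assert (K1 : Rabs (v s - q 0) < e / 2) by (apply H1; auto; lra).
  assert (K2 : Rabs (q (s - t0) - q 0) < e / 2).
  { apply H2. change (Rabs (s - t0 - 0) < d2). rewrite Rminus_0_r. lra. }
  apply Rabs_def2 in K1. apply Rabs_def2 in K2. apply Rabs_def1; lra.
- intros s Hs. split.
  + apply @is_derive_minus; [apply Hv; lra|].
    evar_last.
    * apply (is_derive_comp q (fun s => s - t0)); [apply Hq|].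
      auto_derive; auto.
    * change (1 * dq (s - t0) = dq (s - t0)). ring.
  (* On [(t0, t]] the error in the derivative is largest at [t]; times the length [t - t0] this
     gives the power [S k]. *)
  + apply Rle_trans with (eps * (s - t0) ^ k); [apply Hd; lra|].
    apply Rmult_le_compat_l; [lra|]. apply pow_incr; lra.
Qed.

Lemma expands_const (v : R -> R) (t0 b c : R) :
  t0 < b -> lim1 (fun t => t0 < t < b) v t0 c -> expands 0 v t0 (fun _ => c).
Proof.
intros Hb Hv eps Heps. destruct (Hv eps Heps) as [delta [Hdelta Hd]].
exists (Rmin delta (b - t0)). split; [apply Rmin_pos; lra|].
intros t Ht. pose proof (Rmin_l delta (b - t0)). pose proof (Rmin_r delta (b - t0)).
simpl. rewrite Rmult_1_r. apply Rlt_le, Hd; [lra|]. apply Rabs_def1; lra.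
Qed.

Lemma arc_expands_1 (D : cross) (N0 p : nat) (v : nat -> R -> R) :
  cross_wf D N0 -> (p = 1 \/ p = 3)%nat -> unif_derivs1 1 (arc D p) (v p) ->
  expands 1 (v p) (tip D p)
    (fun s => corner1 D v p 0 + corner1 D v p 1 * s).
Proof.
intros HD Hp Hv.
assert (Hl : forall n, (n <= 1)%nat ->
  lim1 (arc D p) (Derive_n (v p) n) (tip D p) (corner1 D v p n)).
{ intros n Hn. apply (corner1_lim D N0); auto. now apply Hv. }
destruct (arc_interval D N0 p HD Hp) as [b [Hb E]]. rewrite E in *.
apply (expands_integrate 0 _ b _ (Derive_n (v p) 1) _ (fun _ => corner1 D v p 1)); auto.
- rewrite Rmult_0_r, Rplus_0_r. apply (Hl 0%nat). lia.
- intros t Ht. destruct (Hv 1%nat) as [H _]; [lia|].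
  apply (Derive_correct (v p)). exact (H t Ht).
- intros s. auto_derive; auto. ring.
- apply (expands_const _ _ b); auto.
Qed.

Lemma arc_expands_2 (D : cross) (N0 p : nat) (v : nat -> R -> R) :
  cross_wf D N0 -> (p = 1 \/ p = 3)%nat -> unif_derivs1 2 (arc D p) (v p) ->
  expands 2 (v p) (tip D p)
    (fun s => corner1 D v p 0 + corner1 D v p 1 * s + corner1 D v p 2 * s ^ 2 / 2).
Proof.
intros HD Hp Hv.
assert (Hl : forall n, (n <= 2)%nat ->
  lim1 (arc D p) (Derive_n (v p) n) (tip D p) (corner1 D v p n)).
{ intros n Hn. apply (corner1_lim D N0); auto. now apply Hv. }
destruct (arc_interval D N0 p HD Hp) as [b [Hb E]]. rewrite E in *.
apply (expands_integrate 1 _ b _ (Derive_n (v p) 1) _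
  (fun s => corner1 D v p 1 + corner1 D v p 2 * s)); auto.
- replace (_ + _) with (corner1 D v p 0) by field. apply (Hl 0%nat). lia.
- intros t Ht. destruct (Hv 1%nat) as [H _]; [lia|].
  apply (Derive_correct (v p)). exact (H t Ht).
- intros s. auto_derive; auto. field.
- apply (expands_integrate 0 _ b _ (Derive_n (v p) 2) _ (fun _ => corner1 D v p 2)); auto.
  + rewrite Rmult_0_r, Rplus_0_r. apply (Hl 1%nat). lia.
  + intros t Ht. destruct (Hv 2%nat) as [H _]; [lia|].
    apply (Derive_correct (Derive_n (v p) 1)). exact (H t Ht).
  + intros s. auto_derive; auto. ring.
  + apply (expands_const _ _ b); auto.
Qed.

(** A polynomial that is negligible against its own top power is zero: let s tend to 0 for the
    constant term, then divide by s for the slope. *)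
Lemma expands_0_1 (d0 d1 : R) :
  expands 1 (fun _ => 0) 0 (fun s => d0 + d1 * s) -> d0 = 0 /\ d1 = 0.
Proof.
intros H.
assert (E0 : d0 = 0).
{ apply Rabs_eq_0, Rle_antisym; [|apply Rabs_pos].
  apply le_epsilon. intros eps Heps.
  destruct (H 1 Rlt_0_1) as [delta [Hd Hs]].
  pose proof (Rabs_pos d1).
  (* The bound on [d0] is [s] from the tolerance 1 of the expansion plus [Rabs d1 * s] from the
     linear term, hence the denominator. *)
  set (s := Rmin (delta / 2) (eps / (1 + Rabs d1))).
  assert (0 < eps / (1 + Rabs d1)) by (apply Rdiv_lt_0_compat; lra).
  assert (s_pos : 0 < s) by (apply Rmin_pos; lra).
  assert (s_delta : s <= delta / 2) by apply Rmin_l.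
  assert (s_eps : s * (1 + Rabs d1) <= eps).
  { apply Rle_trans with (eps / (1 + Rabs d1) * (1 + Rabs d1)).
    - apply Rmult_le_compat_r; [lra|apply Rmin_r].
    - right. field. lra. }
  assert (K : Rabs (0 - (d0 + d1 * (s - 0))) <= 1 * (s - 0) ^ 1) by (apply Hs; lra).
  replace d0 with ((d0 + d1 * s) + - (d1 * s)) by ring.
  replace (0 - (d0 + d1 * (s - 0))) with (- (d0 + d1 * s)) in K by ring.
  rewrite Rabs_Ropp in K.
  pose proof (Rabs_triang (d0 + d1 * s) (- (d1 * s))) as T.
  rewrite Rabs_Ropp, (Rabs_mult d1 s), (Rabs_pos_eq s) in T by lra.
  simpl in K. lra. }
split; [exact E0|].
apply Rabs_eq_0, Rle_antisym; [|apply Rabs_pos].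
apply le_epsilon. intros eps Heps.
destruct (H eps Heps) as [delta [Hd Hs]].
assert (K : Rabs (0 - (d0 + d1 * (delta / 2 - 0))) <= eps * (delta / 2 - 0) ^ 1)
  by (apply Hs; lra).
replace (0 - (d0 + d1 * (delta / 2 - 0))) with (- d1 * (delta / 2)) in K
  by (rewrite E0; ring).
rewrite Rabs_mult, Rabs_Ropp, (Rabs_pos_eq (delta / 2)) in K by lra.
simpl in K. rewrite Rplus_0_l. apply Rmult_le_reg_r with (delta / 2); lra.
Qed.

(** The quadratic term is itself o(s), so dropping it reduces the first two coefficients to
    [expands_0_1]. *)
Lemma expands_0_2 (d0 d1 d2 : R) :
  expands 2 (fun _ => 0) 0 (fun s => d0 + d1 * s + d2 * s ^ 2 / 2) ->
  d0 = 0 /\ d1 = 0 /\ d2 = 0.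
Proof.
intros H.
assert (E : d0 = 0 /\ d1 = 0).
{ apply expands_0_1. intros eps Heps.
  destruct (H 1 Rlt_0_1) as [delta [Hd Hs]].
  pose proof (Rabs_pos d2).
  assert (0 < eps / (1 + Rabs d2)) by (apply Rdiv_lt_0_compat; lra).
  exists (Rmin delta (eps / (1 + Rabs d2))). split; [apply Rmin_pos; lra|].
  intros s [Hs0 Hs1]. rewrite Rplus_0_l in Hs1.
  pose proof (Rmin_l delta (eps / (1 + Rabs d2))).
  assert (s_eps : s * (1 + Rabs d2) <= eps).
  { apply Rle_trans with (eps / (1 + Rabs d2) * (1 + Rabs d2)).
    - apply Rmult_le_compat_r; [lra|].
      pose proof (Rmin_r delta (eps / (1 + Rabs d2))). lra.
    - right. field. lra. }
  specialize (Hs s ltac:(lra)).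
  rewrite !Rminus_0_r in *.
  replace (0 - (d0 + d1 * s)) with
    ((0 - (d0 + d1 * s + d2 * s ^ 2 / 2)) + d2 * (s ^ 2 / 2)) by field.
  pose proof (Rabs_triang (0 - (d0 + d1 * s + d2 * s ^ 2 / 2)) (d2 * (s ^ 2 / 2))) as T.
  rewrite (Rabs_mult d2), (Rabs_pos_eq (s ^ 2 / 2)) in T by nra.
  simpl in *. nra. }
destruct E as [-> ->]. split; [|split]; auto.
apply Rabs_eq_0, Rle_antisym; [|apply Rabs_pos].
apply le_epsilon. intros eps Heps.
(* Half of [eps], because [d2] comes with the factor s^2 / 2. *)
assert (Heps2 : 0 < eps / 2) by lra.
destruct (H _ Heps2) as [delta [Hd Hs]].
assert (K := Hs (delta / 2) ltac:(lra)).
replace (0 - _) with (- d2 * ((delta / 2) ^ 2 / 2)) in K by field.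
rewrite Rabs_mult, Rabs_Ropp, (Rabs_pos_eq ((delta / 2) ^ 2 / 2)) in K by nra.
rewrite Rminus_0_r in K. rewrite Rplus_0_l.
assert (0 < (delta / 2) ^ 2) by (apply pow_lt; lra).
apply Rmult_le_reg_r with ((delta / 2) ^ 2 / 2); lra.
Qed.

Lemma expands_difference (k : nat) (v : R -> R) (t0 : R) (q q' : R -> R) :
  expands k v t0 q -> expands k v t0 q' ->
  expands k (fun _ => 0) 0 (fun s => q s - q' s).
Proof.
intros Hq Hq' eps Heps.
assert (He2 : 0 < eps / 2) by lra.
destruct (Hq _ He2) as [d [Hd H]]. destruct (Hq' _ He2) as [d' [Hd' H']].
exists (Rmin d d'). split; [apply Rmin_pos; lra|].
intros s Hs. pose proof (Rmin_l d d'). pose proof (Rmin_r d d').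
specialize (H (t0 + s) ltac:(lra)). specialize (H' (t0 + s) ltac:(lra)).
replace (t0 + s - t0) with s in * by ring. rewrite Rminus_0_r.
replace (0 - (q s - q' s)) with ((v (t0 + s) - q s) - (v (t0 + s) - q' s)) by ring.
apply Rabs_le_between in H. apply Rabs_le_between in H'.
apply Rabs_le_between. lra.
Qed.

Lemma expands_ext (k : nat) (v : R -> R) (t0 : R) (q q' : R -> R) :
  (forall s, q s = q' s) -> expands k v t0 q -> expands k v t0 q'.
Proof.
intros E H eps Heps. destruct (H eps Heps) as [d [Hd Hq]].
exists d. split; [exact Hd|]. intros t Ht. rewrite <- E. now apply Hq.
Qed.

Lemma expands_1_unique (v : R -> R) (t0 p0 p1 q0 q1 : R) :
  expands 1 v t0 (fun s => p0 + p1 * s) ->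
  expands 1 v t0 (fun s => q0 + q1 * s) -> p0 = q0 /\ p1 = q1.
Proof.
intros Hp Hq.
destruct (expands_0_1 (p0 - q0) (p1 - q1)); [|lra].
eapply expands_ext; [|exact (expands_difference _ _ _ _ _ Hp Hq)].
intros s. simpl. ring.
Qed.

Lemma expands_2_unique (v : R -> R) (t0 p0 p1 p2 q0 q1 q2 : R) :
  expands 2 v t0 (fun s => p0 + p1 * s + p2 * s ^ 2 / 2) ->
  expands 2 v t0 (fun s => q0 + q1 * s + q2 * s ^ 2 / 2) ->
  p0 = q0 /\ p1 = q1 /\ p2 = q2.
Proof.
intros Hp Hq.
destruct (expands_0_2 (p0 - q0) (p1 - q1) (p2 - q2)); [|lra].
eapply expands_ext; [|exact (expands_difference _ _ _ _ _ Hp Hq)].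
intros s. simpl. field.
Qed.

(** * Transmission conditions at the crossing point *)

(** A non-strict inequality survives the limit, provided that [A] accumulates at [t], which is the
    first hypothesis. *)
Lemma lim1_le (A : R -> Prop) (v q : R -> R) (t l e d : R) :
  (forall eps, 0 < eps -> exists s, A s /\ Rabs (s - t) < eps) ->
  lim1 A v t l -> ex_derive q t -> 0 < d ->
  (forall s, A s -> Rabs (s - t) < d -> Rabs (v s - q s) <= e) ->
  Rabs (l - q t) <= e.
Proof.
intros HA Hv Hq Hd Hvq. apply le_epsilon. intros eps Heps.
assert (He2 : 0 < eps / 2) by lra.
destruct (Hv _ He2) as [d1 [Hd1 H1]].
assert (Hc : filterlim q (locally t) (locally (q t))).
{ apply (ex_derive_continuous q t), Hq. }
destruct (proj1 (filterlim_locally (U := R_UniformSpace) q (q t)) Hc (mkposreal _ He2))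
  as [d2 H2].
pose proof (cond_pos d2).
destruct (HA (Rmin d (Rmin d1 d2))) as [s [As Hs]]; [repeat apply Rmin_pos; lra|].
pose proof (Rmin_l d (Rmin d1 d2)). pose proof (Rmin_r d (Rmin d1 d2)).
pose proof (Rmin_l d1 d2). pose proof (Rmin_r d1 d2).
assert (K1 : Rabs (v s - l) < eps / 2) by (apply H1; auto; lra).
assert (K2 : Rabs (q s - q t) < eps / 2) by (apply H2; change (Rabs (s - t) < d2); lra).
assert (K3 : Rabs (v s - q s) <= e) by (apply Hvq; auto; lra).
apply Rabs_def2 in K1. apply Rabs_def2 in K2. apply Rabs_le_between in K3.
apply Rabs_le_between. lra.
Qed.

Lemma jump_le (v qr ql : R -> R) (t J er el d : R) :
  is_jump v t J -> ex_derive qr t -> ex_derive ql t -> 0 < d ->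
  (forall s, t < s < t + d -> Rabs (v s - qr s) <= er) ->
  (forall s, t - d < s < t -> Rabs (v s - ql s) <= el) ->
  Rabs (J - (qr t - ql t)) <= er + el.
Proof.
intros (vr & vl & Hr & Hl & ->) Dr Dl Hd Br Bl.
assert (Kr : Rabs (vr - qr t) <= er).
{ apply (lim1_le (fun s => t < s) v qr t vr er d); auto.
  - intros eps He. exists (t + eps / 2). split; [lra|]. apply Rabs_def1; lra.
  - apply filterlim_lim1, Hr.
  - intros s Hs Hsd. apply Br. apply Rabs_def2 in Hsd. lra. }
assert (Kl : Rabs (vl - ql t) <= el).
{ apply (lim1_le (fun s => s < t) v ql t vl el d); auto.
  - intros eps He. exists (t - eps / 2). split; [lra|]. apply Rabs_def1; lra.
  - apply filterlim_lim1, Hl.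
  - intros s Hs Hsd. apply Bl. apply Rabs_def2 in Hsd. lra. }
apply Rabs_le_between in Kr. apply Rabs_le_between in Kl.
apply Rabs_le_between. lra.
Qed.

(** * Taylor remainders on a quadrant *)

Lemma quadrant_taylor (D : cross) (N0 p : nat) (u : R -> R -> R) (r e : R) :
  cross_wf D N0 -> quad p -> unif_derivs2 2 (Omega_ D p) u -> 0 < r ->
  (forall m n x y, (m + n = 2)%nat -> Omega_ D p x y ->
     Rabs (x - xi D) <= r -> Rabs (y - zeta D) <= r ->
     Rabs (partial_derive m n u x y - corner2 D u p m n) <= e) ->
  forall x y, Omega_ D p x y ->
    Rabs (x - xi D) <= r -> Rabs (y - zeta D) <= r ->
    Rabs (u x y - jet (corner2 D u p) (x - xi D) (y - zeta D)) <= 4 * e * r ^ 2 /\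
    Rabs (partial_derive 1 0 u x y
      - jet_x (corner2 D u p) (x - xi D) (y - zeta D)) <= 2 * e * r /\
    Rabs (partial_derive 0 1 u x y
      - jet_y (corner2 D u p) (x - xi D) (y - zeta D)) <= 2 * e * r.
Proof.
intros HD Hp [Hu Hc] Hr He.
assert (Hl : forall m n, (m + n <= 2)%nat ->
  lim2 (Omega_ D p) (partial_derive m n u) (xi D) (zeta D) (corner2 D u p m n)).
{ intros m n Hmn. apply (corner2_lim D N0); auto. }
destruct (quadrant_rect D N0 p HD Hp) as (a & b & c & d & E & _ & _ & Hx & Hy).
rewrite E in *. now apply corner_taylor.
Qed.

Lemma second_derivatives_near_corner (D : cross) (N0 p : nat) (u : R -> R -> R) :
  cross_wf D N0 -> quad p -> unif_derivs2 2 (Omega_ D p) u ->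
  forall eps, 0 < eps -> exists r, 0 < r /\
    forall m n x y, (m + n = 2)%nat -> Omega_ D p x y ->
      Rabs (x - xi D) < r -> Rabs (y - zeta D) < r ->
      Rabs (partial_derive m n u x y - corner2 D u p m n) <= eps.
Proof.
intros HD Hp [Hu Hc] eps Heps.
destruct (corner2_lim D N0 p 2 0 u HD Hp (Hc 2%nat 0%nat ltac:(lia)) eps Heps)
  as [d1 [Hd1 H1]].
destruct (corner2_lim D N0 p 1 1 u HD Hp (Hc 1%nat 1%nat ltac:(lia)) eps Heps)
  as [d2 [Hd2 H2]].
destruct (corner2_lim D N0 p 0 2 u HD Hp (Hc 0%nat 2%nat ltac:(lia)) eps Heps)
  as [d3 [Hd3 H3]].
exists (Rmin d1 (Rmin d2 d3)). split; [repeat apply Rmin_pos; lra|].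
intros m n x y Hmn Hxy Hx Hy.
pose proof (Rmin_l d1 (Rmin d2 d3)). pose proof (Rmin_r d1 (Rmin d2 d3)).
pose proof (Rmin_l d2 d3). pose proof (Rmin_r d2 d3).
apply Rlt_le.
assert (E : (m = 2 /\ n = 0 \/ m = 1 /\ n = 1 \/ m = 0 /\ n = 2)%nat) by lia.
destruct E as [[-> ->] | [[-> ->] | [-> ->]]].
- apply H1; auto; lra.
- apply H2; auto; lra.
- apply H3; auto; lra.
Qed.

(** The Lipschitz bound compares points of the open quadrant only, so the corner value is reached
    through an auxiliary point [(s, t)] arbitrarily close to the corner. *)
Lemma second_derivatives_lipschitz (D : cross) (N0 p : nat) (u : R -> R -> R) :
  cross_wf D N0 -> quad p -> unif_derivs2 2 (Omega_ D p) u ->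
  (forall m n, (m + n = 2)%nat -> lipschitz2 (Omega_ D p) (partial_derive m n u)) ->
  exists L, 0 <= L /\ forall r m n x y, (m + n = 2)%nat -> Omega_ D p x y ->
    Rabs (x - xi D) <= r -> Rabs (y - zeta D) <= r ->
    Rabs (partial_derive m n u x y - corner2 D u p m n) <= L * r.
Proof.
intros HD Hp [Hu Hc] HL.
assert (HL' : forall m n, (m + n = 2)%nat -> exists L, 0 <= L /\
  forall r x y, Omega_ D p x y -> Rabs (x - xi D) <= r -> Rabs (y - zeta D) <= r ->
    Rabs (partial_derive m n u x y - corner2 D u p m n) <= L * r).
{ intros m n Hmn. destruct (HL m n Hmn) as [L HLmn].
  pose proof (Rle_abs L). pose proof (Rabs_pos L).
  (* The 2 counts the two coordinates; the absolute value is there because [lipschitz2] does not fix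
     the sign of its constant. *)
  exists (2 * Rabs L). split; [lra|].
  intros r x y Hxy Hx Hy. apply le_epsilon. intros eps Heps.
  assert (He4 : 0 < eps / (2 * (1 + 2 * Rabs L))) by (apply Rdiv_lt_0_compat; lra).
  assert (He2 : 0 < eps / 2) by lra.
  destruct (corner2_lim D N0 p m n u HD Hp (Hc m n ltac:(lia)) _ He2) as [d [Hd Hl]].
  destruct (quadrant_proper D N0 p HD Hp) as [Hex _].
  destruct (Hex (fun q => Omega_ D p (fst q) (snd q) /\
    Rabs (fst q - xi D) < Rmin d (eps / (2 * (1 + 2 * Rabs L))) /\
    Rabs (snd q - zeta D) < Rmin d (eps / (2 * (1 + 2 * Rabs L))))) as [[s t] [Hst [Hs Ht]]].
  { assert (Hm : 0 < Rmin d (eps / (2 * (1 + 2 * Rabs L)))) by (apply Rmin_pos; lra).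
    exists (mkposreal _ Hm). intros q [Q1 Q2] Aq. split; [exact Aq|]. split; [exact Q1|exact Q2]. }
  simpl in Hst, Hs, Ht.
  pose proof (Rmin_l d (eps / (2 * (1 + 2 * Rabs L)))).
  pose proof (Rmin_r d (eps / (2 * (1 + 2 * Rabs L)))).
  set (e4 := eps / (2 * (1 + 2 * Rabs L))) in *.
  assert (Ee : e4 * (2 * (1 + 2 * Rabs L)) = eps) by (unfold e4; field; lra).
  assert (K1 : Rabs (partial_derive m n u s t - corner2 D u p m n) < eps / 2)
    by (apply Hl; auto; lra).
  assert (K2 := HLmn x y s t Hxy Hst).
  assert (Bx : Rabs (x - s) <= r + e4).
  { replace (x - s) with ((x - xi D) - (s - xi D)) by ring.
    eapply Rle_trans; [apply Rabs_triang|]. rewrite Rabs_Ropp. lra. }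
  assert (By : Rabs (y - t) <= r + e4).
  { replace (y - t) with ((y - zeta D) - (t - zeta D)) by ring.
    eapply Rle_trans; [apply Rabs_triang|]. rewrite Rabs_Ropp. lra. }
  assert (K3 : L * (Rabs (x - s) + Rabs (y - t)) <= Rabs L * (2 * r + 2 * e4)).
  { pose proof (Rabs_pos (x - s)). pose proof (Rabs_pos (y - t)).
    apply Rle_trans with (Rabs L * (Rabs (x - s) + Rabs (y - t))).
    - apply Rmult_le_compat_r; lra.
    - apply Rmult_le_compat_l; lra. }
  replace (partial_derive m n u x y - corner2 D u p m n) with
    ((partial_derive m n u x y - partial_derive m n u s t) +
     (partial_derive m n u s t - corner2 D u p m n)) by ring.
  eapply Rle_trans; [apply Rabs_triang|]. nra. }
destruct (HL' 2%nat 0%nat eq_refl) as [L1 [P1 H1]].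
destruct (HL' 1%nat 1%nat eq_refl) as [L2 [P2 H2]].
destruct (HL' 0%nat 2%nat eq_refl) as [L3 [P3 H3]].
(* One constant for the three second derivatives: the sum dominates each summand since all are
   nonnegative. *)
exists (L1 + L2 + L3). split; [lra|].
intros r m n x y Hmn Hxy Hx Hy.
assert (Hr : 0 <= r) by (pose proof (Rabs_pos (x - xi D)); lra).
assert (E : (m = 2 /\ n = 0 \/ m = 1 /\ n = 1 \/ m = 0 /\ n = 2)%nat) by lia.
destruct E as [[-> ->] | [[-> ->] | [-> ->]]].
- specialize (H1 r x y Hxy Hx Hy). nra.
- specialize (H2 r x y Hxy Hx Hy). nra.
- specialize (H3 r x y Hxy Hx Hy). nra.
Qed.

(** The form that [jump_expands] consumes, order 2 for values and order 1 for fluxes, with [A] to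
    become the coefficient of the quadrant. *)
Lemma quadrant_taylor_small (D : cross) (N0 p : nat) (A : R) (u : R -> R -> R) :
  cross_wf D N0 -> quad p -> 0 < A -> unif_derivs2 2 (Omega_ D p) u ->
  forall eps, 0 < eps -> exists delta, 0 < delta /\
    forall r x y, 0 < r < delta -> Omega_ D p x y ->
      Rabs (x - xi D) <= r -> Rabs (y - zeta D) <= r ->
      Rabs (u x y - jet (corner2 D u p) (x - xi D) (y - zeta D)) <= eps * r ^ 2 /\
      Rabs (A * partial_derive 1 0 u x y
        - A * jet_x (corner2 D u p) (x - xi D) (y - zeta D)) <= eps * r ^ 1 /\
      Rabs (A * partial_derive 0 1 u x y
        - A * jet_y (corner2 D u p) (x - xi D) (y - zeta D)) <= eps * r ^ 1.
Proof.
intros HD Hp HA Hu eps Heps.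
(* One [e] for both needs: [4 * e <= eps] for the values and [2 * (A * e) <= eps] for the fluxes. *)
set (e := eps / (4 * (1 + A))).
assert (He : 0 < e) by (apply Rdiv_lt_0_compat; lra).
assert (Ee : eps = 4 * e + 4 * (A * e)) by (unfold e; field; lra).
assert (HAe : 0 < A * e) by (apply Rmult_lt_0_compat; lra).
destruct (second_derivatives_near_corner D N0 p u HD Hp Hu _ He) as [delta [Hdelta B]].
exists delta. split; [exact Hdelta|].
intros r x y Hr Hxy Hx Hy.
destruct (quadrant_taylor D N0 p u r e HD Hp Hu (proj1 Hr)
  (fun m n x y Hmn Hxy Hx Hy => B m n x y Hmn Hxy ltac:(lra) ltac:(lra)) x y Hxy Hx Hy)
  as (T & Tx & Ty).
rewrite <- !Rmult_minus_distr_l, !Rabs_mult, (Rabs_pos_eq A), pow_1 by lra.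
apply (Rmult_le_compat_l A) in Tx; [|lra].
apply (Rmult_le_compat_l A) in Ty; [|lra].
assert (0 < A * e * r) by (apply Rmult_lt_0_compat; lra).
assert (0 < e * r) by (apply Rmult_lt_0_compat; lra).
assert (0 < A * e * r ^ 2) by (apply Rmult_lt_0_compat; [|apply pow_lt]; lra).
rewrite Ee. split; [|split]; lra.
Qed.

(* Here [s] is the coordinate across the interface {s = s0} and [t] the one
   along it, with the crossing point at t = t0. *)
Lemma jump_expands (k : nat) (J : R -> R) (v qr ql : R -> R -> R) (s0 t0 b d0 : R) :
  t0 < b -> 0 < d0 ->
  (forall t, t0 < t < b -> is_jump (fun s => v s t) s0 (J t)) ->
  (forall z, ex_derive (fun s => qr (s - s0) z) s0) ->
  (forall z, ex_derive (fun s => ql (s - s0) z) s0) ->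
  (forall eps, 0 < eps -> exists delta, 0 < delta /\
     forall r s t, 0 < r < delta -> s0 < s < s0 + d0 -> t0 < t < b ->
       Rabs (s - s0) <= r -> Rabs (t - t0) <= r ->
       Rabs (v s t - qr (s - s0) (t - t0)) <= eps * r ^ k) ->
  (forall eps, 0 < eps -> exists delta, 0 < delta /\
     forall r s t, 0 < r < delta -> s0 - d0 < s < s0 -> t0 < t < b ->
       Rabs (s - s0) <= r -> Rabs (t - t0) <= r ->
       Rabs (v s t - ql (s - s0) (t - t0)) <= eps * r ^ k) ->
  expands k J t0 (fun z => qr 0 z - ql 0 z).
Proof.
intros Hb Hd0 HJ Dr Dl Hr Hl eps Heps.
assert (He : 0 < eps / 2) by lra.
destruct (Hr _ He) as [dr [Hdr Br]]. destruct (Hl _ He) as [dl [Hdl Bl]].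
exists (Rmin (b - t0) (Rmin dr dl)). split; [repeat apply Rmin_pos; lra|].
intros t Ht.
pose proof (Rmin_l (b - t0) (Rmin dr dl)). pose proof (Rmin_r (b - t0) (Rmin dr dl)).
pose proof (Rmin_l dr dl). pose proof (Rmin_r dr dl).
set (z := t - t0) in *.
assert (Hz : Rabs (t - t0) <= z) by (rewrite Rabs_pos_eq; unfold z; lra).
assert (z_pos : 0 < z) by (unfold z; lra).
pose proof (Rmin_l d0 z). pose proof (Rmin_r d0 z).
(* The window [Rmin d0 z] across the interface makes [z] the radius of a box containing all points
   compared, so the remainder on each side is measured in the distance along the interface. *)
assert (K := jump_le _ (fun s => qr (s - s0) z) (fun s => ql (s - s0) z) s0 (J t)
  (eps / 2 * z ^ k) (eps / 2 * z ^ k) (Rmin d0 z) (HJ t ltac:(unfold z in *; lra))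
  (Dr z) (Dl z) ltac:(apply Rmin_pos; lra)).
cbv beta in K. rewrite Rminus_diag in K.
replace (eps * z ^ k) with (eps / 2 * z ^ k + eps / 2 * z ^ k) by field.
apply K; intros s Hs; [apply Br | apply Bl]; auto;
  try (apply Rabs_le_between); unfold z in *; lra.
Qed.

(** Omega_2 lies to the right of Gamma_1 and Omega_1 to the left. On the interface X = 0, so of each
    jet only the pure y-derivatives survive, and of each flux jet only u_x and u_xy. *)
Lemma corner_jump_x (D : cross) (N0 : nat) (a_ : nat -> R) (a f : R -> R -> R)
    (phi psi : nat -> R -> R) (g u : R -> R -> R) :
  cross_wf D N0 -> (forall p, quad p -> 0 < a_ p) ->
  cross_solution D a_ a f phi psi g u ->
  (forall p, quad p -> unif_derivs2 2 (Omega_ D p) u) ->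
  expands 2 (phi 1%nat) (zeta D) (fun s =>
    (corner2 D u 2 0 0 - corner2 D u 1 0 0) +
    (corner2 D u 2 0 1 - corner2 D u 1 0 1) * s +
    (corner2 D u 2 0 2 - corner2 D u 1 0 2) * s ^ 2 / 2) /\
  expands 1 (psi 1%nat) (zeta D) (fun s =>
    (a_ 2%nat * corner2 D u 2 1 0 - a_ 1%nat * corner2 D u 1 1 0) +
    (a_ 2%nat * corner2 D u 2 1 1 - a_ 1%nat * corner2 D u 1 1 1) * s).
Proof.
intros HD Ha Hsol Hu.
assert (Q1 : quad 1) by (unfold quad; lia).
assert (Q2 : quad 2) by (unfold quad; lia).
assert (T1 := quadrant_taylor_small D N0 1 _ u HD Q1 (Ha _ Q1) (Hu _ Q1)).
assert (T2 := quadrant_taylor_small D N0 2 _ u HD Q2 (Ha _ Q2) (Hu _ Q2)).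
assert (J : forall t, zeta D < t < l4 D ->
  is_jump (fun s => u s t) (xi D) (phi 1%nat t) /\
  is_jump (fun s => flux_x a u s t) (xi D) (psi 1%nat t)).
{ intros t Ht. apply (sol_jump_x _ _ _ _ _ _ _ _ Hsol); [now left|exact Ht]. }
pose proof HD as (_ & _ & _ & _ & Hxi & Hzeta).
(* Width of the strips beside the interface that remain inside Omega. *)
set (d0 := Rmin (xi D - l1 D) (l2 D - xi D)).
assert (Hd0 : 0 < d0) by (apply Rmin_pos; lra).
assert (Hlo : d0 <= xi D - l1 D) by apply Rmin_l.
assert (Hhi : d0 <= l2 D - xi D) by apply Rmin_r.
split.
- eapply expands_ext; [|apply (jump_expands 2 _ u
    (jet (corner2 D u 2)) (jet (corner2 D u 1))
    (xi D) (zeta D) (l4 D) d0); try lra].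
  + intros s. simpl. unfold jet. field.
  + intros t Ht. now apply J.
  + intros z. unfold jet. auto_derive; auto.
  + intros z. unfold jet. auto_derive; auto.
  + intros eps Heps. destruct (T2 eps Heps) as [delta [Hdelta B]].
    exists delta. split; [exact Hdelta|]. intros r s t Hr Hs Ht Ds Dt.
    apply (B r s t); auto. simpl; lra.
  + intros eps Heps. destruct (T1 eps Heps) as [delta [Hdelta B]].
    exists delta. split; [exact Hdelta|]. intros r s t Hr Hs Ht Ds Dt.
    apply (B r s t); auto. simpl; lra.
- eapply expands_ext; [|apply (jump_expands 1 _ (flux_x a u)
    (fun X Y => a_ 2%nat * jet_x (corner2 D u 2) X Y)
    (fun X Y => a_ 1%nat * jet_x (corner2 D u 1) X Y)
    (xi D) (zeta D) (l4 D) d0); try lra].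
  + intros s. simpl. unfold jet_x. ring.
  + intros t Ht. now apply J.
  + intros z. unfold jet_x. auto_derive; auto.
  + intros z. unfold jet_x. auto_derive; auto.
  + intros eps Heps. destruct (T2 eps Heps) as [delta [Hdelta B]].
    exists delta. split; [exact Hdelta|]. intros r s t Hr Hs Ht Ds Dt.
    assert (Hst : Omega_ D 2 s t) by (simpl; lra).
    unfold flux_x. rewrite (sol_coeff _ _ _ _ _ _ _ _ Hsol 2 _ _ Q2 Hst).
    now apply (B r s t).
  + intros eps Heps. destruct (T1 eps Heps) as [delta [Hdelta B]].
    exists delta. split; [exact Hdelta|]. intros r s t Hr Hs Ht Ds Dt.
    assert (Hst : Omega_ D 1 s t) by (simpl; lra).
    unfold flux_x. rewrite (sol_coeff _ _ _ _ _ _ _ _ Hsol 1 _ _ Q1 Hst).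
    now apply (B r s t).
Qed.

(** The mirror image of [corner_jump_x]: since [jump_expands] takes the coordinate across the
    interface first, the arguments of [u] and of the jets are swapped. *)
Lemma corner_jump_y (D : cross) (N0 : nat) (a_ : nat -> R) (a f : R -> R -> R)
    (phi psi : nat -> R -> R) (g u : R -> R -> R) :
  cross_wf D N0 -> (forall p, quad p -> 0 < a_ p) ->
  cross_solution D a_ a f phi psi g u ->
  (forall p, quad p -> unif_derivs2 2 (Omega_ D p) u) ->
  expands 2 (phi 3%nat) (xi D) (fun s =>
    (corner2 D u 2 0 0 - corner2 D u 3 0 0) +
    (corner2 D u 2 1 0 - corner2 D u 3 1 0) * s +
    (corner2 D u 2 2 0 - corner2 D u 3 2 0) * s ^ 2 / 2) /\
  expands 1 (psi 3%nat) (xi D) (fun s =>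
    (a_ 2%nat * corner2 D u 2 0 1 - a_ 3%nat * corner2 D u 3 0 1) +
    (a_ 2%nat * corner2 D u 2 1 1 - a_ 3%nat * corner2 D u 3 1 1) * s).
Proof.
intros HD Ha Hsol Hu.
assert (Q3 : quad 3) by (unfold quad; lia).
assert (Q2 : quad 2) by (unfold quad; lia).
assert (T3 := quadrant_taylor_small D N0 3 _ u HD Q3 (Ha _ Q3) (Hu _ Q3)).
assert (T2 := quadrant_taylor_small D N0 2 _ u HD Q2 (Ha _ Q2) (Hu _ Q2)).
assert (J : forall t, xi D < t < l2 D ->
  is_jump (fun s => u t s) (zeta D) (phi 3%nat t) /\
  is_jump (fun s => flux_y a u t s) (zeta D) (psi 3%nat t)).
{ intros t Ht. apply (sol_jump_y _ _ _ _ _ _ _ _ Hsol); [now left|exact Ht]. }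
pose proof HD as (_ & _ & _ & _ & Hxi & Hzeta).
set (d0 := Rmin (zeta D - l3 D) (l4 D - zeta D)).
assert (Hd0 : 0 < d0) by (apply Rmin_pos; lra).
assert (Hlo : d0 <= zeta D - l3 D) by apply Rmin_l.
assert (Hhi : d0 <= l4 D - zeta D) by apply Rmin_r.
split.
- eapply expands_ext; [|apply (jump_expands 2 _ (fun s t => u t s)
    (fun X Y => jet (corner2 D u 2) Y X) (fun X Y => jet (corner2 D u 3) Y X)
    (zeta D) (xi D) (l2 D) d0); try lra].
  + intros s. simpl. unfold jet. field.
  + intros t Ht. now apply J.
  + intros z. unfold jet. auto_derive; auto.
  + intros z. unfold jet. auto_derive; auto.
  + intros eps Heps. destruct (T2 eps Heps) as [delta [Hdelta B]].
    exists delta. split; [exact Hdelta|]. intros r s t Hr Hs Ht Ds Dt.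
    apply (B r t s); auto. simpl; lra.
  + intros eps Heps. destruct (T3 eps Heps) as [delta [Hdelta B]].
    exists delta. split; [exact Hdelta|]. intros r s t Hr Hs Ht Ds Dt.
    apply (B r t s); auto. simpl; lra.
- eapply expands_ext; [|apply (jump_expands 1 _ (fun s t => flux_y a u t s)
    (fun X Y => a_ 2%nat * jet_y (corner2 D u 2) Y X)
    (fun X Y => a_ 3%nat * jet_y (corner2 D u 3) Y X)
    (zeta D) (xi D) (l2 D) d0); try lra].
  + intros s. simpl. unfold jet_y. ring.
  + intros t Ht. now apply J.
  + intros z. unfold jet_y. auto_derive; auto.
  + intros z. unfold jet_y. auto_derive; auto.
  + intros eps Heps. destruct (T2 eps Heps) as [delta [Hdelta B]].
    exists delta. split; [exact Hdelta|]. intros r s t Hr Hs Ht Ds Dt.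
    assert (Hst : Omega_ D 2 t s) by (simpl; lra).
    unfold flux_y. rewrite (sol_coeff _ _ _ _ _ _ _ _ Hsol 2 _ _ Q2 Hst).
    now apply (B r t s).
  + intros eps Heps. destruct (T3 eps Heps) as [delta [Hdelta B]].
    exists delta. split; [exact Hdelta|]. intros r s t Hr Hs Ht Ds Dt.
    assert (Hst : Omega_ D 3 t s) by (simpl; lra).
    unfold flux_y. rewrite (sol_coeff _ _ _ _ _ _ _ _ Hsol 3 _ _ Q3 Hst).
    now apply (B r t s).
Qed.

(** On an open quadrant the coefficient is locally constant and leaves the flux derivatives, which
    depend only on nearby values. The corner limit of [f] is then that of the second derivatives of
    [u]. *)
Lemma corner_pde (D : cross) (N0 p : nat) (a_ : nat -> R) (a f : R -> R -> R)
    (phi psi : nat -> R -> R) (g u : R -> R -> R) :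
  cross_wf D N0 -> quad p -> cross_solution D a_ a f phi psi g u ->
  unif_derivs2 2 (Omega_ D p) u ->
  corner2 D f p 0 0 = - (a_ p * (corner2 D u p 2 0 + corner2 D u p 0 2)).
Proof.
intros HD Hp Hsol [Hu Hc].
apply (corner2_eq D N0); auto.
assert (Hf : forall x y, Omega_ D p x y -> f x y =
  - (a_ p * (partial_derive 2 0 u x y + partial_derive 0 2 u x y))).
{ intros x y Hxy.
  pose proof HD as (_ & _ & _ & _ & Hxi & Hzeta).
  rewrite <- (sol_pde _ _ _ _ _ _ _ _ Hsol x y).
  - assert (Hloc : locally_2d (Omega_ D p) x y).
    { destruct (quadrant_rect D N0 p HD Hp) as (a0 & b & c & d & E & _).
      rewrite E in *. now apply rect_locally_2d. }
    assert (Ex : partial_derive 1 0 (flux_x a u) x y = a_ p * partial_derive 2 0 u x y).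
    { change (partial_derive 1 0 (flux_x a u) x y) with
        (Derive (fun t => flux_x a u t y) x).
      rewrite (Derive_ext_loc _ (fun t => a_ p * partial_derive 1 0 u t y)).
      - apply Derive_scal.
      - apply (filter_imp (fun t => Omega_ D p t y)).
        + intros t Ht. unfold flux_x.
          now rewrite (sol_coeff _ _ _ _ _ _ _ _ Hsol p t y Hp Ht).
        + now apply locally_2d_1d_const_y. }
    assert (Ey : partial_derive 0 1 (flux_y a u) x y = a_ p * partial_derive 0 2 u x y).
    { change (partial_derive 0 1 (flux_y a u) x y) with
        (Derive (fun t => flux_y a u x t) y).
      rewrite (Derive_ext_loc _ (fun t => a_ p * partial_derive 0 1 u x t)).
      - apply Derive_scal.
      - apply (filter_imp (fun t => Omega_ D p x t)).
        + intros t Ht. unfold flux_y.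
          now rewrite (sol_coeff _ _ _ _ _ _ _ _ Hsol p x t Hp Ht).
        + now apply locally_2d_1d_const_x. }
    rewrite Ex, Ey. ring.
  - destruct p as [|[|[|[|[|]]]]]; simpl in Hxy; unfold Omega; (lra || contradiction).
  - intros [[q [_ Hq]]|Hq];
      destruct p as [|[|[|[|[|]]]]]; simpl in Hxy; try contradiction; try lra;
      destruct q as [|[|[|[|[|]]]]]; simpl in Hq; try contradiction; lra. }
assert (L1 := corner2_lim D N0 p 2 0 u HD Hp (Hc 2%nat 0%nat ltac:(lia))).
assert (L2 := corner2_lim D N0 p 0 2 u HD Hp (Hc 0%nat 2%nat ltac:(lia))).
intros eps Heps.
pose proof (Rabs_pos (a_ p)).
assert (He : 0 < eps / (2 * (1 + Rabs (a_ p)))) by (apply Rdiv_lt_0_compat; lra).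
destruct (L1 _ He) as [d1 [Hd1 H1]]. destruct (L2 _ He) as [d2 [Hd2 H2]].
exists (Rmin d1 d2). split; [apply Rmin_pos; lra|].
intros x y Hxy Hx Hy. pose proof (Rmin_l d1 d2). pose proof (Rmin_r d1 d2).
specialize (H1 x y Hxy ltac:(lra) ltac:(lra)).
specialize (H2 x y Hxy ltac:(lra) ltac:(lra)).
change (partial_derive 0 0 f x y) with (f x y). rewrite (Hf x y Hxy).
set (X := partial_derive 2 0 u x y - corner2 D u p 2 0) in *.
set (Y := partial_derive 0 2 u x y - corner2 D u p 0 2) in *.
replace (_ - _) with (- (a_ p * (X + Y))) by (unfold X, Y; ring).
rewrite Rabs_Ropp, Rabs_mult.
set (e := eps / (2 * (1 + Rabs (a_ p)))) in *.
assert (Ee : e * (2 * (1 + Rabs (a_ p))) = eps) by (unfold e; field; lra).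
pose proof (Rabs_triang X Y).
apply Rle_lt_trans with (Rabs (a_ p) * (2 * e)).
- apply Rmult_le_compat_l; lra.
- nra.
Qed.

(** * The stencil and the right-hand side *)

Lemma sum_n_m_0_1 (F : nat -> R) : sum_n_m F 0 1 = F 0%nat + F 1%nat.
Proof. rewrite sum_n_Sm, sum_n_n by lia. reflexivity. Qed.

Lemma sum_n_m_0_2 (F : nat -> R) : sum_n_m F 0 2 = F 0%nat + F 1%nat + F 2%nat.
Proof. rewrite sum_n_Sm, sum_n_m_0_1 by lia. reflexivity. Qed.

Lemma sumZ_0_1 (F : Z -> R) : sumZ 0 1 F = F 0%Z + F 1%Z.
Proof. apply sum_n_m_0_1. Qed.

Lemma sumZ_m1_1 (F : Z -> R) : sumZ (-1) 1 F = F (-1)%Z + F 0%Z + F 1%Z.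
Proof. apply sum_n_m_0_2. Qed.

Lemma sum_Lambda1_2 (T : nat -> nat -> R) : sum_Lambda1 2 T =
  T 0%nat 0%nat + T 1%nat 0%nat + T 2%nat 0%nat + (T 0%nat 1%nat + T 1%nat 1%nat).
Proof.
unfold sum_Lambda1. simpl Nat.min. rewrite sum_n_m_0_1.
simpl Nat.sub. now rewrite sum_n_m_0_2, sum_n_m_0_1.
Qed.

Lemma sum_Lambda_0 (T : nat -> nat -> R) : sum_Lambda 0 T = T 0%nat 0%nat.
Proof. unfold sum_Lambda. simpl Nat.sub. now rewrite !sum_n_n. Qed.

Lemma G_0_0 (x y : R) : G 0 0 x y = 1.
Proof. unfold G. simpl Nat.div. rewrite sum_n_n. simpl. field. Qed.

Lemma G_0_1 (x y : R) : G 0 1 x y = y.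
Proof. unfold G. simpl Nat.div. rewrite sum_n_n. simpl. field. Qed.

(** Replacing u_xx by -f/a - u_yy in a jet leaves u_yy times this harmonic polynomial plus f/a times
    [H 0 0], whose Laplacian is -1. *)
Lemma G_0_2 (x y : R) : G 0 2 x y = y ^ 2 / 2 - x ^ 2 / 2.
Proof. unfold G. simpl Nat.div. rewrite sum_n_m_0_1. simpl. field. Qed.

Lemma G_1_0 (x y : R) : G 1 0 x y = x.
Proof. unfold G. simpl Nat.div. rewrite sum_n_n. simpl. field. Qed.

Lemma G_1_1 (x y : R) : G 1 1 x y = x * y.
Proof. unfold G. simpl Nat.div. rewrite sum_n_n. simpl. field. Qed.

Lemma H_0_0 (x y : R) : H 0 0 x y = - x ^ 2 / 2.
Proof. unfold H. simpl Nat.div. simpl Nat.add. rewrite sum_n_n. simpl. field. Qed.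

(** * The five-point stencil: moments, signs and exactness on jets *)

Definition five_point (C : Z -> Z -> R) : Prop :=
  C 0%Z 0%Z = 1 /\ C (-1)%Z (-1)%Z = 0 /\ C (-1)%Z 1%Z = 0 /\
  C 1%Z (-1)%Z = 0 /\ C 1%Z 1%Z = 0.

Lemma stencil_five_point (a_ : nat -> R) (w1 w2 : R) : five_point (stencil a_ w1 w2).
Proof. repeat split. Qed.

Lemma stencil_op_five_point (C : Z -> Z -> R) (u : R -> R -> R) (h x y : R) :
  five_point C ->
  stencil_op C u h x y = u x y + C (-1)%Z 0%Z * u (x - h) y + C 1%Z 0%Z * u (x + h) y +
    C 0%Z (-1)%Z * u x (y - h) + C 0%Z 1%Z * u x (y + h).
Proof.
intros (C00 & Cmm & Cmp & Cpm & Cpp).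
unfold stencil_op. rewrite !sumZ_m1_1, C00, Cmm, Cmp, Cpm, Cpp.
replace (x + -1 * h) with (x - h) by ring. replace (x + 1 * h) with (x + h) by ring.
replace (y + -1 * h) with (y - h) by ring. replace (y + 1 * h) with (y + h) by ring.
replace (x + 0 * h) with x by ring. replace (y + 0 * h) with y by ring.
ring.
Qed.

(* The conditions under which the stencil annihilates the part of the jet left
   free by the transmission conditions and the equation: the value, u_x, u_y,
   u_xy and u_yy of u_2 at the crossing point, in this order. *)
Definition moment_conditions (C : Z -> Z -> R) (a_ : nat -> R) (w1 w2 : R) : Prop :=
  let W := C (-1)%Z 0%Z in let E := C 1%Z 0%Z in
  let S := C 0%Z (-1)%Z in let N := C 0%Z 1%Z in
  let q1 := a_ 2%nat / a_ 1%nat in let q3 := a_ 2%nat / a_ 3%nat in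
  1 + W + E + S + N = 0 /\
  w1 + W * q1 * (w1 - 1) + E * (w1 + 1) + S * w1 + N * w1 = 0 /\
  w2 + W * w2 + E * w2 + S * q3 * (w2 - 1) + N * (w2 + 1) = 0 /\
  w1 * w2 + W * q1 * (w1 - 1) * w2 + E * (w1 + 1) * w2 +
    S * q3 * w1 * (w2 - 1) + N * w1 * (w2 + 1) = 0 /\
  (w2 ^ 2 - w1 ^ 2) + W * (w2 ^ 2 - (w1 - 1) ^ 2) + E * (w2 ^ 2 - (w1 + 1) ^ 2) +
    S * ((w2 - 1) ^ 2 - w1 ^ 2) + N * ((w2 + 1) ^ 2 - w1 ^ 2) = 0.

(** Each of s1, ..., s4 is negative on the open unit square, and their weights in [beta] are
    products of positive coefficients. *)
Lemma beta_pos (a_ : nat -> R) (w1 w2 : R) :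
  (forall p, quad p -> 0 < a_ p) -> 0 < w1 < 1 -> 0 < w2 < 1 -> 0 < beta a_ w1 w2.
Proof.
intros Ha Hw1 Hw2. unfold beta.
assert (P1 : 0 < a_ 1%nat) by (apply Ha; unfold quad; lia).
assert (P2 : 0 < a_ 2%nat) by (apply Ha; unfold quad; lia).
assert (P3 : 0 < a_ 3%nat) by (apply Ha; unfold quad; lia).
assert (Q : 0 < w1 * w2 < 1) by nra.
assert (K4 : 0 < - s4 w1 w2).
{ unfold s4. replace (- _) with (2 * ((1 - w2) * (w1 ^ 2 + w1 * w2 + w2 + 1))) by ring.
  repeat apply Rmult_lt_0_compat; nra. }
assert (K3 : 0 < - s3 w1 w2).
(* The only negative monomial, -2 w1 w2, is absorbed by the constant 2, as w1 w2 < 1. *)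
{ unfold s3. replace (- _) with
    (2 * (w2 + 1) * w1 ^ 2 + 2 * (w1 * w2) * w2 + 2 * w2 ^ 2 + 2 * (1 - w1 * w2)) by ring.
  nra. }
assert (K2 : 0 < - s2 w1 w2).
{ unfold s2. replace (- _) with (2 * ((1 - w2) * ((1 - w1) * (w1 + w2 + 1)))) by ring.
  repeat apply Rmult_lt_0_compat; lra. }
assert (K1 : 0 < - s1 w1 w2).
{ unfold s1. replace (- _) with (2 * ((1 - w1) * (w1 * w2 + w2 ^ 2 + w1 + 1))) by ring.
  repeat apply Rmult_lt_0_compat; nra. }
assert (0 < a_ 1%nat * a_ 2%nat * - s4 w1 w2) by (repeat apply Rmult_lt_0_compat; lra).
assert (0 < a_ 1%nat * a_ 3%nat * - s3 w1 w2) by (repeat apply Rmult_lt_0_compat; lra).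
assert (0 < a_ 2%nat ^ 2 * - s2 w1 w2) by (apply Rmult_lt_0_compat; [apply pow_lt|]; lra).
assert (0 < a_ 2%nat * a_ 3%nat * - s1 w1 w2) by (repeat apply Rmult_lt_0_compat; lra).
lra.
Qed.

(** Five conditions on four coefficients are compatible because the u_xy condition is w2 times the
    u_x one plus w1 times the u_y one minus w1 w2 times the one for the value. *)
Lemma stencil_moments (a_ : nat -> R) (w1 w2 : R) :
  (forall p, quad p -> 0 < a_ p) -> 0 < w1 < 1 -> 0 < w2 < 1 ->
  moment_conditions (stencil a_ w1 w2) a_ w1 w2.
Proof.
intros Ha Hw1 Hw2.
pose proof (beta_pos a_ w1 w2 Ha Hw1 Hw2) as Hb.
assert (P1 : 0 < a_ 1%nat) by (apply Ha; unfold quad; lia).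
assert (P3 : 0 < a_ 3%nat) by (apply Ha; unfold quad; lia).
unfold moment_conditions, stencil.
unfold r1, r2, r3, r4, r5, r6, r7, r8, r9, r10, r11, r12.
unfold beta, s1, s2, s3, s4 in *.
repeat split; field; lra.
Qed.

(** All numerators are nonnegative: r1, ..., r4 are so on the unit interval, and r5, ..., r12 are
    products of one of these with w1, w2, 1 - w1 or 1 - w2. *)
Lemma stencil_nonpos (a_ : nat -> R) (w1 w2 : R) :
  (forall p, quad p -> 0 < a_ p) -> 0 < w1 < 1 -> 0 < w2 < 1 ->
  stencil a_ w1 w2 (-1) 0 <= 0 /\ stencil a_ w1 w2 1 0 <= 0 /\
  stencil a_ w1 w2 0 (-1) <= 0 /\ stencil a_ w1 w2 0 1 <= 0.
Proof.
intros Ha Hw1 Hw2.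
pose proof (beta_pos a_ w1 w2 Ha Hw1 Hw2) as Hb.
assert (P1 : 0 < a_ 1%nat) by (apply Ha; unfold quad; lia).
assert (P2 : 0 < a_ 2%nat) by (apply Ha; unfold quad; lia).
assert (P3 : 0 < a_ 3%nat) by (apply Ha; unfold quad; lia).
assert (P22 : 0 <= a_ 2%nat ^ 2) by apply pow2_ge_0.
assert (R1 : 0 <= r1 w2) by (unfold r1; pose proof (pow2_ge_0 w2); lra).
assert (R2 : 0 <= r2 w2).
{ replace (r2 w2) with ((1 - w2) * (1 + 2 * w2)) by (unfold r2; ring).
  apply Rmult_le_pos; lra. }
assert (R3 : 0 <= r3 w1).
{ replace (r3 w1) with ((1 - w1) * (1 + 2 * w1)) by (unfold r3; ring).
  apply Rmult_le_pos; lra. }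
assert (R4 : 0 <= r4 w1) by (unfold r4; pose proof (pow2_ge_0 w1); lra).
assert (E5 : r5 w1 w2 = w2 * r3 w1) by (unfold r5, r3; ring).
assert (E6 : r6 w1 w2 = (1 - w2) * r3 w1) by (unfold r6, r3; ring).
assert (E7 : r7 w1 w2 = w2 * r4 w1) by (unfold r7, r4; ring).
assert (E8 : r8 w1 w2 = (1 - w2) * r4 w1) by (unfold r8, r4; ring).
assert (E9 : r9 w1 w2 = (1 - w1) * r1 w2) by (unfold r9, r1; ring).
assert (E10 : r10 w1 w2 = (1 - w1) * r2 w2) by (unfold r10, r2; ring).
assert (E11 : r11 w1 w2 = w1 * r1 w2) by (unfold r11, r1; ring).
assert (E12 : r12 w1 w2 = w1 * r2 w2) by (unfold r12, r2; ring).
assert (Hdiv : forall z, 0 <= z -> - z / beta a_ w1 w2 <= 0).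
{ intros z Hz. unfold Rdiv. rewrite Ropp_mult_distr_l_reverse.
  assert (0 <= z * / beta a_ w1 w2); [|lra].
  apply Rmult_le_pos; [lra|]. apply Rlt_le, Rinv_0_lt_compat, Hb. }
repeat split; apply Hdiv; rewrite ?E5, ?E6, ?E7, ?E8, ?E9, ?E10, ?E11, ?E12;
  repeat (lra || apply Rplus_le_le_0_compat || apply Rmult_le_pos).
Qed.

Lemma stencil_sign_condition (a_ : nat -> R) (w1 w2 : R) :
  (forall p, quad p -> 0 < a_ p) -> 0 < w1 < 1 -> 0 < w2 < 1 ->
  sign_condition (stencil a_ w1 w2).
Proof.
intros Ha Hw1 Hw2. destruct (stencil_nonpos a_ w1 w2 Ha Hw1 Hw2) as (W & E & S & N).
split; [exact Rlt_0_1|]. intros k l Hk Hl Hkl.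
assert (Ek : (k = -1 \/ k = 0 \/ k = 1)%Z) by lia.
assert (El : (l = -1 \/ l = 0 \/ l = 1)%Z) by lia.
destruct Ek as [-> | [-> | ->]], El as [-> | [-> | ->]];
  try assumption; try (simpl; lra). now destruct Hkl.
Qed.

Lemma stencil_summation_condition (a_ : nat -> R) (w1 w2 : R) :
  (forall p, quad p -> 0 < a_ p) -> 0 < w1 < 1 -> 0 < w2 < 1 ->
  summation_condition (stencil a_ w1 w2).
Proof.
intros Ha Hw1 Hw2. destruct (stencil_moments a_ w1 w2 Ha Hw1 Hw2) as [M0 _].
unfold summation_condition. rewrite !sumZ_m1_1.
destruct (stencil_five_point a_ w1 w2) as (-> & -> & -> & -> & ->). lra.
Qed.

(** The jump along Gamma_3 supplies u_xx of u_3, so on Omega_3 the equation eliminates u_yy instead;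
    this is why [G3] and [H3] exchange the variables. The term of [F1] appears when u_xx of u_2 is
    in turn replaced by -f_2/a_2 - u_yy. *)
Lemma stencil_jets_eq_rhs (C : Z -> Z -> R) (a_ : nat -> R) (w1 w2 h : R)
    (fc : nat -> nat -> nat -> R) (phic psic : nat -> nat -> R)
    (c1 c2 c3 : nat -> nat -> R) :
  (forall p, quad p -> 0 < a_ p) ->
  five_point C -> moment_conditions C a_ w1 w2 ->
  fc 1%nat 0%nat 0%nat = - (a_ 1%nat * (c1 2%nat 0%nat + c1 0%nat 2%nat)) ->
  fc 2%nat 0%nat 0%nat = - (a_ 2%nat * (c2 2%nat 0%nat + c2 0%nat 2%nat)) ->
  fc 3%nat 0%nat 0%nat = - (a_ 3%nat * (c3 2%nat 0%nat + c3 0%nat 2%nat)) ->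
  (forall n, (n <= 2)%nat -> phic 1%nat n = c2 0%nat n - c1 0%nat n) ->
  (forall n, (n <= 2)%nat -> phic 3%nat n = c2 n 0%nat - c3 n 0%nat) ->
  (forall n, (n <= 1)%nat -> psic 1%nat n = a_ 2%nat * c2 1%nat n - a_ 1%nat * c1 1%nat n) ->
  (forall n, (n <= 1)%nat -> psic 3%nat n = a_ 2%nat * c2 n 1%nat - a_ 3%nat * c3 n 1%nat) ->
  jet c2 (w1 * h) (w2 * h) +
  C (-1)%Z 0%Z * jet c1 ((w1 - 1) * h) (w2 * h) +
  C 1%Z 0%Z * jet c2 ((w1 + 1) * h) (w2 * h) +
  C 0%Z (-1)%Z * jet c3 (w1 * h) ((w2 - 1) * h) +
  C 0%Z 1%Z * jet c2 (w1 * h) ((w2 + 1) * h) =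
  rhs_F C w1 w2 h a_ fc phic psic.
Proof.
intros Ha (C00 & Cmm & Cmp & Cpm & Cpp) (M0 & M1 & M2 & M3 & M4) F1' F2' F3' P1 P3 Q1 Q3.
assert (A1 : a_ 1%nat <> 0) by (apply Rgt_not_eq, Ha; unfold quad; lia).
assert (A2 : a_ 2%nat <> 0) by (apply Rgt_not_eq, Ha; unfold quad; lia).
assert (A3 : a_ 3%nat <> 0) by (apply Rgt_not_eq, Ha; unfold quad; lia).
assert (A4 : a_ 4%nat <> 0) by (apply Rgt_not_eq, Ha; unfold quad; lia).
unfold rhs_F. rewrite !sum_Lambda1_2, sum_Lambda_0, sum_n_m_0_2, sum_n_m_0_1.
unfold F1, F0, Phi1, Phi0, Psi1, Psi0.
(* In [F1] the sum over s is empty for m < 2 and consists of s = 1 for m = 2. *)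
simpl Nat.div. rewrite !(sum_n_m_zero _ 1 0), !sum_n_n by lia.
change (@zero R_AbelianMonoid) with 0.
unfold G1, G3, G4, H1, H2, H3, H4. rewrite !sumZ_0_1, Cmm, Cmp, Cpm, Cpp, C00.
rewrite ?G_0_0, ?G_0_1, ?G_0_2, ?G_1_0, ?G_1_1, ?H_0_0.
(* In [Psi1] the index [m + n - 1] is truncated to 0 at m = n = 0, harmlessly, since [oddR 0]
   annihilates that term. *)
simpl Nat.sub. simpl Nat.add.
rewrite F1', F2', F3', !P1, !P3, !Q1, !Q3 by lia.
unfold jet.
generalize dependent (C (-1)%Z 0%Z). generalize dependent (C 1%Z 0%Z).
generalize dependent (C 0%Z (-1)%Z). generalize dependent (C 0%Z 1%Z).
intros N S E W M0 M1 M2 M3 M4.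
apply Rminus_diag_uniq.
(* The difference of the two sides is each free coefficient of the jet of u_2 times its moment. *)
transitivity (c2 0%nat 0%nat * (1 + W + E + S + N) +
  c2 1%nat 0%nat * h *
    (w1 + W * (a_ 2%nat / a_ 1%nat) * (w1 - 1) + E * (w1 + 1) + S * w1 + N * w1) +
  c2 0%nat 1%nat * h *
    (w2 + W * w2 + E * w2 + S * (a_ 2%nat / a_ 3%nat) * (w2 - 1) + N * (w2 + 1)) +
  c2 1%nat 1%nat * h ^ 2 *
    (w1 * w2 + W * (a_ 2%nat / a_ 1%nat) * (w1 - 1) * w2 + E * (w1 + 1) * w2 +
     S * (a_ 2%nat / a_ 3%nat) * w1 * (w2 - 1) + N * w1 * (w2 + 1)) +
  c2 0%nat 2%nat * h ^ 2 / 2 *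
    ((w2 ^ 2 - w1 ^ 2) + W * (w2 ^ 2 - (w1 - 1) ^ 2) + E * (w2 ^ 2 - (w1 + 1) ^ 2) +
     S * ((w2 - 1) ^ 2 - w1 ^ 2) + N * ((w2 + 1) ^ 2 - w1 ^ 2))).
- unfold oddR. simpl. field. auto.
- rewrite M0, M1, M2, M3, M4. field.
Qed.

(** * Truncation error *)

(** The off-centre coefficients are nonpositive with sum -1, so the factor 2 is uniform in [w1],
    [w2] and the coefficients [a_]. *)
Lemma stencil_combination_le (a_ : nat -> R) (w1 w2 x0 x1 x2 x3 x4 e : R) :
  (forall p, quad p -> 0 < a_ p) -> 0 < w1 < 1 -> 0 < w2 < 1 ->
  Rabs x0 <= e -> Rabs x1 <= e -> Rabs x2 <= e -> Rabs x3 <= e -> Rabs x4 <= e ->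
  Rabs (x0 + stencil a_ w1 w2 (-1) 0 * x1 + stencil a_ w1 w2 1 0 * x2 +
    stencil a_ w1 w2 0 (-1) * x3 + stencil a_ w1 w2 0 1 * x4) <= 2 * e.
Proof.
intros Ha Hw1 Hw2 B0 B1 B2 B3 B4.
destruct (stencil_nonpos a_ w1 w2 Ha Hw1 Hw2) as (W & E & S & N).
destruct (stencil_moments a_ w1 w2 Ha Hw1 Hw2) as [M0 _].
assert (Hmul : forall c x, c <= 0 -> Rabs x <= e -> c * e <= c * x <= - (c * e)).
{ intros c x Hc Hx. apply Rabs_le_between in Hx. split; nra. }
apply (Hmul _ _ W) in B1. apply (Hmul _ _ E) in B2.
apply (Hmul _ _ S) in B3. apply (Hmul _ _ N) in B4.
apply (f_equal (fun z => z * e)) in M0.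
apply Rabs_le_between in B0. apply Rabs_le_between. lra.
Qed.

Lemma mesh_h_pos (D : cross) (N0 N1 i j : nat) (w1 w2 : R) :
  cross_wf D N0 -> cross_point D N0 N1 i j w1 w2 -> 0 < mesh_h D N1.
Proof.
intros [Hl _] [Hi _]. apply Rdiv_lt_0_compat; [lra|]. apply lt_0_INR. lia.
Qed.

(* Since |C_{k,l}| sums to 2, the error is at most twice the Taylor remainder
   4 e (2 h)^2 on the box of half-width 2 h, divided by h. *)
Lemma truncation_le (D : cross) (N0 : nat) (a_ : nat -> R) (a f : R -> R -> R)
    (phi psi : nat -> R -> R) (g u : R -> R -> R)
    (N1 i j : nat) (w1 w2 e : R) :
  cross_wf D N0 -> (forall p, quad p -> 0 < a_ p) ->
  cross_solution D a_ a f phi psi g u ->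
  (forall p, quad p -> unif_derivs2 2 (Omega_ D p) u) ->
  (forall p, quad p -> unif_derivs1 2 (arc D p) (phi p)) ->
  (forall p, quad p -> unif_derivs1 1 (arc D p) (psi p)) ->
  cross_point D N0 N1 i j w1 w2 ->
  2 * mesh_h D N1 < xi D - l1 D -> 2 * mesh_h D N1 < l2 D - xi D ->
  2 * mesh_h D N1 < zeta D - l3 D -> 2 * mesh_h D N1 < l4 D - zeta D ->
  (forall p m n x y, quad p -> (m + n = 2)%nat -> Omega_ D p x y ->
     Rabs (x - xi D) <= 2 * mesh_h D N1 -> Rabs (y - zeta D) <= 2 * mesh_h D N1 ->
     Rabs (partial_derive m n u x y - corner2 D u p m n) <= e) ->
  Rabs (truncation D a_ f phi psi u N1 i j w1 w2) <= 32 * e * mesh_h D N1.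
Proof.
intros HD Ha Hsol Hu Hphi Hpsi Hpt Hm1 Hm2 Hm3 Hm4 He.
pose proof (mesh_h_pos D N0 N1 i j w1 w2 HD Hpt) as Hh.
destruct Hpt as (_ & _ & _ & Hw1 & Hw2 & Ex & Ey).
unfold truncation. set (h := mesh_h D N1) in *.
set (x := mesh_x D N1 i) in *. set (y := mesh_y D N1 j) in *.
assert (Q1 : quad 1) by (unfold quad; lia).
assert (Q2 : quad 2) by (unfold quad; lia).
assert (Q3 : quad 3) by (unfold quad; lia).
destruct (corner_jump_x D N0 a_ a f phi psi g u HD Ha Hsol Hu) as [X1 X2].
destruct (corner_jump_y D N0 a_ a f phi psi g u HD Ha Hsol Hu) as [Y1 Y2].
destruct (expands_2_unique _ _ _ _ _ _ _ _
  (arc_expands_2 D N0 1 phi HD (or_introl eq_refl) (Hphi _ Q1)) X1) as (P10 & P11 & P12).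
destruct (expands_2_unique _ _ _ _ _ _ _ _
  (arc_expands_2 D N0 3 phi HD (or_intror eq_refl) (Hphi _ Q3)) Y1) as (P30 & P31 & P32).
destruct (expands_1_unique _ _ _ _ _ _
  (arc_expands_1 D N0 1 psi HD (or_introl eq_refl) (Hpsi _ Q1)) X2) as (S10 & S11).
destruct (expands_1_unique _ _ _ _ _ _
  (arc_expands_1 D N0 3 psi HD (or_intror eq_refl) (Hpsi _ Q3)) Y2) as (S30 & S31).
assert (Hcase1 : forall n, (n <= 1)%nat -> (n = 0 \/ n = 1)%nat) by lia.
assert (Hcase2 : forall n, (n <= 2)%nat -> (n = 0 \/ n = 1 \/ n = 2)%nat) by lia.
(* With F replaced by the stencil applied to the jets, only the stencil of the Taylor remainders is
   left. *)
unfold F_h. rewrite <- (stencil_jets_eq_rhs _ a_ w1 w2 h (corner2 D f) (corner1 D phi)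
  (corner1 D psi) (corner2 D u 1) (corner2 D u 2) (corner2 D u 3) Ha
  (stencil_five_point a_ w1 w2) (stencil_moments a_ w1 w2 Ha Hw1 Hw2)).
2-4: eapply corner_pde; eauto.
2: intros n Hn; destruct (Hcase2 n Hn) as [-> | [-> | ->]]; assumption.
2: intros n Hn; destruct (Hcase2 n Hn) as [-> | [-> | ->]]; assumption.
2: intros n Hn; destruct (Hcase1 n Hn) as [-> | ->]; assumption.
2: intros n Hn; destruct (Hcase1 n Hn) as [-> | ->]; assumption.
rewrite (stencil_op_five_point _ _ _ _ _ (stencil_five_point a_ w1 w2)).
assert (w1h : 0 < w1 * h < h) by nra.
assert (w2h : 0 < w2 * h < h) by nra.
assert (T : forall p s t X Y, quad p -> s - xi D = X -> t - zeta D = Y ->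
  Omega_ D p s t -> - (2 * h) <= X <= 2 * h -> - (2 * h) <= Y <= 2 * h ->
  Rabs (u s t - jet (corner2 D u p) X Y) <= 4 * e * (2 * h) ^ 2).
{ intros p s t X Y Hp <- <- Hst HX HY.
  apply (quadrant_taylor D N0 p u (2 * h) e HD Hp (Hu p Hp)); auto.
  - lra.
  - now apply Rabs_le_between.
  - now apply Rabs_le_between. }
(* As 0 < w1, w2 < 1, the centre and its east and north neighbours are in Omega_2, the west one in
   Omega_1 and the south one in Omega_3, with offsets from the crossing point between -h and 2 h. *)
assert (T0 := T 2%nat x y (w1 * h) (w2 * h) Q2 ltac:(lra) ltac:(lra)
  ltac:(simpl; lra) ltac:(lra) ltac:(lra)).
assert (TW := T 1%nat (x - h) y ((w1 - 1) * h) (w2 * h) Q1 ltac:(lra) ltac:(lra)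
  ltac:(simpl; lra) ltac:(lra) ltac:(lra)).
assert (TE := T 2%nat (x + h) y ((w1 + 1) * h) (w2 * h) Q2 ltac:(lra) ltac:(lra)
  ltac:(simpl; lra) ltac:(lra) ltac:(lra)).
assert (TS := T 3%nat x (y - h) (w1 * h) ((w2 - 1) * h) Q3 ltac:(lra) ltac:(lra)
  ltac:(simpl; lra) ltac:(lra) ltac:(lra)).
assert (TN := T 2%nat x (y + h) (w1 * h) ((w2 + 1) * h) Q2 ltac:(lra) ltac:(lra)
  ltac:(simpl; lra) ltac:(lra) ltac:(lra)).
assert (K := stencil_combination_le a_ w1 w2 _ _ _ _ _ _ Ha Hw1 Hw2 T0 TW TE TS TN).
rewrite Rabs_mult, (Rabs_pos_eq (/ h)) by (apply Rlt_le, Rinv_0_lt_compat, Hh).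
apply Rmult_le_reg_l with h; [exact Hh|].
rewrite <- Rmult_assoc, Rinv_r, Rmult_1_l by lra.
eapply Rle_trans; [|eapply Rle_trans; [exact K|]].
- right. f_equal. ring.
- right. ring.
Qed.

Lemma second_derivatives_near_corner_all (D : cross) (N0 : nat) (u : R -> R -> R) :
  cross_wf D N0 -> (forall p, quad p -> unif_derivs2 2 (Omega_ D p) u) ->
  forall eps, 0 < eps -> exists r, 0 < r /\
    forall p m n x y, quad p -> (m + n = 2)%nat -> Omega_ D p x y ->
      Rabs (x - xi D) < r -> Rabs (y - zeta D) < r ->
      Rabs (partial_derive m n u x y - corner2 D u p m n) <= eps.
Proof.
intros HD Hu eps Heps.
assert (Hex : forall p, quad p -> exists r, 0 < r /\
  forall m n x y, (m + n = 2)%nat -> Omega_ D p x y ->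
    Rabs (x - xi D) < r -> Rabs (y - zeta D) < r ->
    Rabs (partial_derive m n u x y - corner2 D u p m n) <= eps).
{ intros p Hp. apply (second_derivatives_near_corner D N0); auto. }
destruct (Hex 1%nat) as [d1 [Hd1 B1]]; [unfold quad; lia|].
destruct (Hex 2%nat) as [d2 [Hd2 B2]]; [unfold quad; lia|].
destruct (Hex 3%nat) as [d3 [Hd3 B3]]; [unfold quad; lia|].
destruct (Hex 4%nat) as [d4 [Hd4 B4]]; [unfold quad; lia|].
exists (Rmin (Rmin d1 d2) (Rmin d3 d4)). split; [repeat apply Rmin_pos; lra|].
intros p m n x y Hp Hmn Hxy Hx Hy.
pose proof (Rmin_l (Rmin d1 d2) (Rmin d3 d4)).
pose proof (Rmin_r (Rmin d1 d2) (Rmin d3 d4)).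
pose proof (Rmin_l d1 d2). pose proof (Rmin_r d1 d2).
pose proof (Rmin_l d3 d4). pose proof (Rmin_r d3 d4).
unfold quad in Hp.
assert (E : (p = 1 \/ p = 2 \/ p = 3 \/ p = 4)%nat) by lia.
destruct E as [-> | [-> | [-> | ->]]];
  [apply B1 | apply B2 | apply B3 | apply B4]; auto; lra.
Qed.

Lemma second_derivatives_lipschitz_all (D : cross) (N0 : nat) (u : R -> R -> R) :
  cross_wf D N0 -> (forall p, quad p -> unif_derivs2 2 (Omega_ D p) u) ->
  (forall p m n, quad p -> (m + n = 2)%nat ->
     lipschitz2 (Omega_ D p) (partial_derive m n u)) ->
  exists L, forall r p m n x y, quad p -> (m + n = 2)%nat -> Omega_ D p x y ->
    Rabs (x - xi D) <= r -> Rabs (y - zeta D) <= r ->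
    Rabs (partial_derive m n u x y - corner2 D u p m n) <= L * r.
Proof.
intros HD Hu HL.
assert (Hex : forall p, quad p -> exists L, 0 <= L /\
  forall r m n x y, (m + n = 2)%nat -> Omega_ D p x y ->
    Rabs (x - xi D) <= r -> Rabs (y - zeta D) <= r ->
    Rabs (partial_derive m n u x y - corner2 D u p m n) <= L * r).
{ intros p Hp. apply (second_derivatives_lipschitz D N0); auto. }
destruct (Hex 1%nat) as [L1 [P1 B1]]; [unfold quad; lia|].
destruct (Hex 2%nat) as [L2 [P2 B2]]; [unfold quad; lia|].
destruct (Hex 3%nat) as [L3 [P3 B3]]; [unfold quad; lia|].
destruct (Hex 4%nat) as [L4 [P4 B4]]; [unfold quad; lia|].
exists (L1 + L2 + L3 + L4).
intros r p m n x y Hp Hmn Hxy Hx Hy.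
assert (Hr : 0 <= r) by (pose proof (Rabs_pos (x - xi D)); lra).
assert (Hle : forall L, L <= L1 + L2 + L3 + L4 -> L * r <= (L1 + L2 + L3 + L4) * r)
  by (intros L HLr; apply Rmult_le_compat_r; lra).
unfold quad in Hp.
assert (E : (p = 1 \/ p = 2 \/ p = 3 \/ p = 4)%nat) by lia.
destruct E as [-> | [-> | [-> | ->]]].
- apply Rle_trans with (L1 * r); [now apply B1|apply Hle; lra].
- apply Rle_trans with (L2 * r); [now apply B2|apply Hle; lra].
- apply Rle_trans with (L3 * r); [now apply B3|apply Hle; lra].
- apply Rle_trans with (L4 * r); [now apply B4|apply Hle; lra].
Qed.

(** Keeps the box of half-width 2 h around the crossing point, and with it the stencil, inside
    Omega. *)
Lemma margin_pos (D : cross) (N0 : nat) : cross_wf D N0 -> exists d, 0 < d /\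
  forall h, h < d -> 2 * h < xi D - l1 D /\ 2 * h < l2 D - xi D /\
    2 * h < zeta D - l3 D /\ 2 * h < l4 D - zeta D.
Proof.
intros (_ & _ & _ & _ & Hx & Hy).
set (m1 := Rmin (xi D - l1 D) (l2 D - xi D)).
set (m2 := Rmin (zeta D - l3 D) (l4 D - zeta D)).
exists (Rmin m1 m2 / 2). split.
- assert (0 < Rmin m1 m2) by (repeat apply Rmin_pos; lra). lra.
- intros h Hh. pose proof (Rmin_l m1 m2). pose proof (Rmin_r m1 m2).
  assert (m1 <= xi D - l1 D) by apply Rmin_l. assert (m1 <= l2 D - xi D) by apply Rmin_r.
  assert (m2 <= zeta D - l3 D) by apply Rmin_l. assert (m2 <= l4 D - zeta D) by apply Rmin_r.
  lra.
Qed.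

Theorem theorem3p3 :
  (forall (D : cross) (N0 : nat) (a_ : nat -> R) (a f : R -> R -> R)
          (phi psi : nat -> R -> R) (g u : R -> R -> R),
     cross_wf D N0 ->
     (forall p, quad p -> 0 < a_ p) ->
     cross_solution D a_ a f phi psi g u ->
     (forall p, quad p -> unif_derivs2 2 (Omega_ D p) u) ->
     (forall p, quad p -> unif_derivs2 0 (Omega_ D p) f) ->
     (forall p, quad p -> unif_derivs1 2 (arc D p) (phi p)) ->
     (forall p, quad p -> unif_derivs1 1 (arc D p) (psi p)) ->
     ((forall p m n, quad p -> (m + n = 2)%nat ->
         lipschitz2 (Omega_ D p) (partial_derive m n u)) ->
      exists K h0, 0 < h0 /\
      forall (N1 i j : nat) (w1 w2 : R),
        cross_point D N0 N1 i j w1 w2 -> mesh_h D N1 < h0 ->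
        Rabs (truncation D a_ f phi psi u N1 i j w1 w2) <= K * mesh_h D N1 ^ 2) /\
     (forall eps, 0 < eps ->
        exists h0, 0 < h0 /\
        forall (N1 i j : nat) (w1 w2 : R),
          cross_point D N0 N1 i j w1 w2 -> mesh_h D N1 < h0 ->
          Rabs (truncation D a_ f phi psi u N1 i j w1 w2) <= eps * mesh_h D N1)) /\
  (forall (a_ : nat -> R) (w1 w2 : R),
     (forall p, quad p -> 0 < a_ p) -> 0 < w1 < 1 -> 0 < w2 < 1 ->
     0 < beta a_ w1 w2 /\
     sign_condition (stencil a_ w1 w2) /\
     summation_condition (stencil a_ w1 w2)).
Proof.
split; [|intros a_ w1 w2 Ha Hw1 Hw2; split; [|split];
  auto using beta_pos, stencil_sign_condition, stencil_summation_condition].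
intros D N0 a_ a f phi psi g u HD Ha Hsol Hu _ Hphi Hpsi.
destruct (margin_pos D N0 HD) as [d [Hd Hmargin]].
split.
- intros HL.
  destruct (second_derivatives_lipschitz_all D N0 u HD Hu HL) as [L HLip].
  (* The Lipschitz bound on the box gives [e = L * (2 * h)], whence 32 * 2 = 64. *)
  exists (64 * L), d. split; [exact Hd|].
  intros N1 i j w1 w2 Hpt Hh.
  destruct (Hmargin _ Hh) as (Hm1 & Hm2 & Hm3 & Hm4).
  replace (64 * L * mesh_h D N1 ^ 2) with (32 * (L * (2 * mesh_h D N1)) * mesh_h D N1)
    by ring.
  apply (truncation_le D N0 a_ a f phi psi g u); auto.
- intros eps Heps.
  assert (He : 0 < eps / 32) by lra.
  destruct (second_derivatives_near_corner_all D N0 u HD Hu _ He) as [r [Hr Hnear]].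
  (* [r / 2], so that the box of half-width 2 h stays within distance [r] of the corner. *)
  exists (Rmin d (r / 2)). split; [apply Rmin_pos; lra|].
  intros N1 i j w1 w2 Hpt Hh.
  pose proof (Rmin_l d (r / 2)). pose proof (Rmin_r d (r / 2)).
  destruct (Hmargin (mesh_h D N1)) as (Hm1 & Hm2 & Hm3 & Hm4); [lra|].
  replace (eps * mesh_h D N1) with (32 * (eps / 32) * mesh_h D N1) by field.
  apply (truncation_le D N0 a_ a f phi psi g u); auto.
  intros p m n x y Hp Hmn Hxy Hx Hy. apply Hnear; auto; lra.
Qed.
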